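(* Let $H$ be a real Hilbert space and let $\mathcal{T}\subset\mathcal{B}(H)$ be a commutative family of essentially selfadjoint operators, i.e. $TS=ST$ for all $T,S\in\mathcal{T}$, and $T^*-T$ is compact for every $T\in\mathcal{T}$. Then $\mathcal{T}$ has an invariant subspace: there is a closed subspace $L$ of $H$ with $\{0\}\ne L\ne H$ and $TL\subset L$ for all $T\in\mathcal{T}$.
   Context: $\mathcal{B}(H)$ is the algebra of all bounded linear operators on $H$. An operator $T\in\mathcal{B}(H)$ is essentially selfadjoint if $T^*-T$ is a compact operator, where $T^*$ is the Hilbert space adjoint. ''Invariant subspace'' means closed, non-trivial (different from $\{0\}$ and the whole space) invariant subspace.
   Formalization: The real Hilbert space H is additionally assumed to have dimension at least 3 (possibly infinite); without this the claim fails: no non-trivial subspace exists in dimension 0 or 1, and rotation of the plane by 90 degrees has no invariant line. *)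

(* Defs.v *)
From HB Require Import structures.
From mathcomp Require Import all_boot all_order all_algebra.
From mathcomp Require Import sesquilinear.
From mathcomp Require Import all_classical all_reals all_analysis.
From mathcomp Require Import ring lra.
Set Implicit Arguments.
Unset Strict Implicit.
Unset Printing Implicit Defensive.
Import Order.TTheory GRing.Theory Num.Theory numFieldNormedType.Exports.
Local Open Scope classical_set_scope.
Local Open Scope ring_scope.

(* A real Hilbert space is a completeNormedModType H over a realType, together
   with a positive definite symmetric bilinear form ip : {dot H for idfun}
   satisfying hilbert_norm ip. *)
Definition hilbert_norm (R : realType) (H : completeNormedModType R)
    (ip : {dot H for idfun}) : Prop :=
  forall x : H, `|x| ^+ 2 = ip x x.

(* The dimension is at least n, possibly infinite. In dimension at most 1 no
   non-trivial subspace exists, and in dimension 2 a rotation of the plane has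
   no invariant line: the existence of invariant subspaces needs n = 3. *)
Definition dim_ge (R : realType) (H : lmodType R) (n : nat) : Prop :=
  exists e : 'I_n -> H, forall c : 'I_n -> R,
    \sum_(i < n) c i *: e i = 0 -> forall i, c i = 0.

(* See linear_boundedP for the equivalence with an estimate |T x| <= M |x|. *)
Definition bounded_operator (R : realType) (H : normedModType R)
    (T : {linear H -> H}) : Prop :=
  bounded_near T (nbhs (0 : H)).

Definition compact_operator (R : realType) (H : normedModType R)
    (K : H -> H) : Prop :=
  precompact (K @` [set x | `|x| <= 1]).

(* The point chosen by get is unique (adjoint_uniq), and it exists for every
   bounded T (adjointP). *)
Definition adjoint (R : realType) (H : completeNormedModType R)
    (ip : {dot H for idfun}) (T : H -> H) (y : H) : H :=
  get [set z | forall x, ip (T x) y = ip x z].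

Definition essentially_selfadjoint (R : realType)
    (H : completeNormedModType R) (ip : {dot H for idfun})
    (T : {linear H -> H}) : Prop :=
  compact_operator (adjoint ip T \- T).

Definition invariant_subspace (R : realType) (H : normedModType R)
    (F : set {linear H -> H}) (L : set H) : Prop :=
  [/\ closed L, submod_closed [in L], L <> [set 0], L <> setT
    & forall T : {linear H -> H}, F T -> T @` L `<=` L].

Section Adjoint.
Variables (R : realType) (H : completeNormedModType R).
Variable ip : {dot H for idfun}.
Hypothesis ipE : hilbert_norm ip.

Lemma ipC (x y : H) : ip x y = ip y x.
Proof. by have := @hermitian_subproof _ _ _ _ ip x y; rewrite expr0 mul1r. Qed.

Lemma ipDl (x y z : H) : ip (x + y) z = ip x z + ip y z.
Proof. exact: linearDl. Qed.

Lemma ipDr (x y z : H) : ip x (y + z) = ip x y + ip x z.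
Proof. exact: linearDr. Qed.

Lemma ipZl (a : R) (x y : H) : ip (a *: x) y = a * ip x y.
Proof. exact: linearZl_LR. Qed.

Lemma ipZr (a : R) (x y : H) : ip x (a *: y) = a * ip x y.
Proof. by rewrite ipC ipZl ipC. Qed.

Lemma ip_inj (y z : H) : (forall x, ip x y = ip x z) -> y = z.
Proof.
move=> h; apply/eqP; rewrite -subr_eq0 -normr_eq0 -sqrf_eq0 ipE.
by rewrite -scaleN1r ipDr h ipZr mulN1r subrr.
Qed.

Lemma adjoint_uniq (T : H -> H) (y z : H) :
  (forall x, ip (T x) y = ip x z) -> adjoint ip T y = z.
Proof.
move=> h; apply: ip_inj => x.
by rewrite -h (@getPex _ [set z | forall x, ip (T x) y = ip x z])//; exists z.
Qed.

Lemma cauchy_schwarz (x y : H) : `|ip x y| <= `|x| * `|y|.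
Proof.
have [->|y0] := eqVneq y 0.
  by rewrite -[0 : H](scale0r 0) ipZr mul0r scale0r !normr0 mulr0.
have yy0 : 0 < ip y y by rewrite -ipE exprn_gt0// normr_gt0.
rewrite -ler_sqr ?nnegrE ?mulr_ge0// exprMn !ipE real_normK ?num_real//.
have : 0 <= ip (ip y y *: x - ip x y *: y) (ip y y *: x - ip x y *: y).
  by rewrite -ipE sqr_ge0.
rewrite -scaleNr !(ipDl, ipDr, ipZl, ipZr) (ipC y x).
set a := ip x x; set b := ip y y; set c := ip x y => h.
have {}h : 0 <= b * (a * b - c ^+ 2).
  apply: le_trans h _; rewrite le_eqVlt; apply/orP; left; apply/eqP.
  by ring.
by rewrite -subr_ge0 -(pmulr_rge0 _ yy0).
Qed.

Lemma riesz (f : H -> R) (M : R) :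
  (forall x y, f (x + y) = f x + f y) -> (forall a x, f (a *: x) = a * f x) ->
  (forall x, `|f x| <= M * `|x|) -> exists z, forall x, f x = ip x z.
Proof.
move=> fD fZ fM.
pose J x := ip x x - 2 * f x.
have JM x : - M ^+ 2 <= J x.
  have := fM x; rewrite ler_norml => /andP[_ fx].
  by have := sqr_ge0 (`|x| - M); rewrite /J -ipE !expr2; lra.
have Jinf : has_inf (range J).
  by split; [exists (J 0), 0 | exists (- M ^+ 2) => _ [x _ <-]].
set m := inf (range J).
have mJ x : m <= J x by apply: ge_inf; [exact: Jinf.2 | exists x].
have JD x y : J (x + y) = J x + 2 * (ip x y - f y) + ip y y.
  by rewrite /J fD !(ipDl, ipDr) (ipC y x); ring.
have minseq n : exists x, J x < m + n.+1%:R^-1.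
  have [|_ [x _ <-] ?] := inf_adherent _ Jinf (eps := n.+1%:R^-1).
    by rewrite invr_gt0.
  by exists x.
have [u um] := choice minseq.
have grad n x : (ip (u n) x - f x) ^+ 2 <= `|x| ^+ 2 * n.+1%:R^-1.
  have [->|x0] := eqVneq x 0.
    have f0 : f 0 = 0 by rewrite -(scale0r 0) fZ mul0r.
    by rewrite f0 -[X in ip _ X](scale0r 0) ipZr mul0r subrr normr0 !expr0n mul0r.
  rewrite ipE; have xx0 : 0 < ip x x by rewrite -ipE exprn_gt0// normr_gt0.
  have := um n; have := mJ (u n + (- (ip (u n) x - f x) / ip x x) *: x).
  rewrite JD fZ ipZl !ipZr; set a := ip (u n) x - f x; set s := ip x x.
  have -> : J (u n) + 2 * (- a / s * ip (u n) x - - a / s * f x) +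
      - a / s * (- a / s * s) = J (u n) - a ^+ 2 / s.
    by rewrite /a; field; rewrite gt_eqF.
  move=> h1 h2; rewrite mulrC -ler_pdivrMr//.
  move: h1 h2; move: (a ^+ 2 / s) (n.+1%:R^-1) (J (u n)) => v1 v2 v3.
  by lra.
have dist p q : `|u p - u q| ^+ 2 <= 2 * p.+1%:R^-1 + 2 * q.+1%:R^-1.
  have := mJ (2^-1 *: (u p + u q)); have := um p; have := um q.
  rewrite /J ipE fZ fD -scaleN1r !(ipDl, ipDr, ipZl, ipZr) (ipC (u q) (u p)).
  move: (p.+1%:R^-1) (q.+1%:R^-1) => v1 v2.
  by lra.
have uc : cauchy (u n @[n --> \oo]).
  apply: cauchy_exP => e e0.
  have [N _ NE] : \forall n \near \oo, n.+1%:R^-1 < (e / 2) ^+ 2.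
    by apply: near_infty_natSinv_lt (PosNum (exprn_gt0 2 (divr_gt0 e0 (ltr0n R 2)))).
  exists (u N); exists N => // n /= Nn; rewrite -ball_normE /ball_ /=.
  rewrite -ltr_sqr ?nnegrE ?(ltW e0)//.
  apply: le_lt_trans (dist N n) _.
  have := NE N (leqnn N); have := NE n Nn => /=.
  move: (N.+1%:R^-1) (n.+1%:R^-1) => v1 v2.
  by rewrite !expr2; lra.
pose z : H := lim (u n @[n --> \oo]).
have {}uc : u n @[n --> \oo] --> z by apply/cauchy_cvgP.
exists z => x; rewrite ipC; apply/eqP; rewrite eq_sym -subr_eq0 -normr_le0.
apply/ler_addgt0Pr => e e0; rewrite add0r.
have d0 : 0 < e / (2 * (`|x| + 1)).
  by rewrite divr_gt0// mulr_gt0// ltr_wpDl.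
near \oo => n.
have zn : `|z - u n| < e / (2 * (`|x| + 1)).
  by near: n; move/cvgrPdist_lt: uc; exact.
have nE : n.+1%:R^-1 < (e / (2 * (`|x| + 1))) ^+ 2.
  by near: n; apply: near_infty_natSinv_lt (PosNum (exprn_gt0 2 d0)).
have -> : ip z x - f x = ip (z - u n) x + (ip (u n) x - f x).
  by rewrite -scaleN1r ipDl ipZl; ring.
apply: le_trans (ler_normD _ _) _.
have h1 : `|ip (z - u n) x| <= e / (2 * (`|x| + 1)) * `|x|.
  by apply: le_trans (cauchy_schwarz _ _) _; rewrite ler_wpM2r// ltW.
have h2 : `|ip (u n) x - f x| <= e / (2 * (`|x| + 1)) * `|x|.
  have b0 : 0 <= e / (2 * (`|x| + 1)) * `|x| by rewrite mulr_ge0// ltW.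
  rewrite -ler_sqr ?nnegrE// real_normK ?num_real//.
  apply: le_trans (grad n x) _.
  by rewrite exprMn mulrC ler_wpM2r ?sqr_ge0// ltW.
apply: le_trans (lerD h1 h2) _.
rewrite -mulrDr mulrAC ler_pdivrMr ?mulr_gt0 ?ltr_wpDl//.
by rewrite ler_wpM2l ?(ltW e0)//; lra.
Unshelve. all: by end_near. Qed.

Lemma adjointP (T : {linear H -> H}) : bounded_operator T ->
  forall x y, ip (T x) y = ip x (adjoint ip T y).
Proof.
move=> /linear_boundedP /pinfty_ex_gt0 [M M0 TM] x y.
apply: (@getPex _ [set z | forall x, ip (T x) y = ip x z]).
apply: (@riesz (fun x => ip (T x) y) (M * `|y|)).
- by move=> u v; rewrite linearD ipDl.
- by move=> a u; rewrite linearZ ipZl.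
- move=> u; apply: le_trans (cauchy_schwarz _ _) _.
  by rewrite mulrAC ler_wpM2r.
Qed.

End Adjoint.

(* Main.v *)
Require Import Defs.
From mathcomp Require Import all_boot all_order all_algebra.
From mathcomp Require Import sesquilinear.
From mathcomp Require Import all_classical all_reals all_analysis.
From mathcomp Require Import ring lra.
Import Order.TTheory GRing.Theory Num.Theory numFieldNormedType.Exports.
Local Open Scope classical_set_scope.
Local Open Scope ring_scope.
Set Implicit Arguments.
Unset Strict Implicit.
Unset Printing Implicit Defensive.

(** Suppose that there is no invariant subspace, and let [A] be the unital algebra
generated by the family; it is commutative and [S^* - S] is compact for [S] in [A].

If [T] in [A] has essential norm less than 1, then some power of [T] has norm at
most 1/2, unless the identity is compact: otherwise some quadratic
[1 - 2 s cos phi T + s^2 T^2], [0 <= s <= 1], is not invertible (the averages of the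
resolvents over the n-th roots of unity invert [1 - s^n T^n], as in Rickart's
elementary proof of the spectral radius formula), so it vanishes by irreducibility.

Moreau's decomposition applied to the closed cone generated by the [S^2 x] shows
that for all nonzero [x], [y] there is an [S] in [A] with [(S^2 x, y) < 0]. On a
ball [U] of center [x0] that does not contain [0], this gives by weak compactness
finitely many operators, of the form [1 - e (S^2 + th)] or [1 - e], such that each
[x] in [U] is mapped into [U] by one of them. They have essential norm less than 1
and commute, so long products of them tend to 0, which contradicts
[0] not being in [U] (Hilden's argument).

If the identity is compact, each [S] in [A] is annihilated by a polynomial
[(t - a)^2 + d] with [d >= 0], so [A] is spanned by 1 and one element [J], and the
bidual orthogonal of [{x, J x}] is invariant. *)

(** * Signs and zeros in the inner product *)

Section InnerProduct.
Context {R : realType} {H : completeNormedModType R} (ip : {dot H for idfun}).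
Implicit Types x y : H.

Lemma ipNl x y : ip (- x) y = - ip x y.
Proof. by rewrite -scaleN1r ipZl mulN1r. Qed.

Lemma ipNr x y : ip x (- y) = - ip x y.
Proof. by rewrite ipC ipNl ipC. Qed.

Lemma ip0l x : ip 0 x = 0.
Proof. by rewrite -(scale0r (0 : H)) ipZl mul0r. Qed.

Lemma ip0r x : ip x 0 = 0.
Proof. by rewrite ipC ip0l. Qed.

End InnerProduct.

(* Linear identities between vectors become ring identities after pairing both
   sides with an arbitrary vector. *)
Ltac vring ip_norm := apply: (ip_inj ip_norm) => ?;
  rewrite [LHS]ipC [RHS]ipC ?(ipDl, ipNl, ipZl); ring.

(** * Compact maps along ultrafilters *)

(** The image of an ultrafilter is an ultrafilter, and ultrafilters on a compact set converge in
    it. *)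
Lemma ultra_compact (I : Type) (T : topologicalType) (G : set_system I)
    (A : set T) (f : I -> T) : UltraFilter G -> compact A ->
  (\forall i \near G, A (f i)) -> exists2 p, A p & f i @[i --> G] --> p.
Proof.
move=> UG cA GA.
have UfG : UltraFilter (f @ G).
  split; first exact: fmap_proper_filter.
  move=> E PE GE; apply/seteqP; split => // B EB.
  have [//|GnB] := in_ultra_setVsetC (f @^-1` B) UG.
  have EnB : E (B `&` ~` B) by apply: filterI => //; exact: GE.
  by have [x []] := filter_ex EnB.
by move: cA; rewrite compact_ultra => /(_ _ UfG GA)[p [Ap fp]]; exists p.
Qed.

Section Operators.
Context {R : realType} {H : completeNormedModType R}.
Implicit Types (T S K C : H -> H) (u v x y z : H).

(* Compactness of a possibly nonlinear map, phrased so that it is inherited by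
   sums and by compositions with bounded operators on either side. *)
Definition ucompact K := forall (I : Type) (G : set_system I), UltraFilter G ->
  forall (u : I -> H) (M : R), (\forall i \near G, `|u i| <= M) ->
  cvg (K (u i) @[i --> G]).

Lemma ucompactD K C : ucompact K -> ucompact C -> ucompact (fun x => K x + C x).
Proof.
move=> cK cC I G UG u M uM.
by apply: is_cvgD; [exact: cK uM | exact: cC uM].
Qed.

Lemma ucompactZ a K : ucompact K -> ucompact (fun x => a *: K x).
Proof.
by move=> cK I G UG u M uM; apply: is_cvgZl_tmp; exact: cK uM.
Qed.

Lemma ucompact_compr K T (M : R) : (forall x, `|T x| <= M * `|x|) ->
  ucompact K -> ucompact (K \o T).
Proof.
move=> TM cK I G UG u N uN.
(* The sign of [M] is unknown; [Num.max M 0] makes multiplication monotone. *)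
apply: (cK _ _ UG (T \o u) (Num.max M 0 * N)); apply: filterS uN => i uN /=.
apply: le_trans (TM _) _.
apply: (@le_trans _ _ (Num.max M 0 * `|u i|)).
  by rewrite ler_wpM2r// le_max lexx.
by rewrite ler_wpM2l// le_max lexx orbT.
Qed.

Lemma bounded_cvg (T : {linear H -> H}) (M : R) I (G : set_system I)
    (FG : Filter G) (f : I -> H) y : (forall x, `|T x| <= M * `|x|) ->
  f i @[i --> G] --> y -> T (f i) @[i --> G] --> T y.
Proof.
move=> TM; apply: continuous_cvg; apply: bounded_linear_continuous.
apply/linear_boundedP; exists M; split; first exact: num_real.
by move=> r Mr x; apply: le_trans (TM x) _; rewrite ler_wpM2r// ltW.
Qed.

Lemma ucompact_compl (T : {linear H -> H}) K (M : R) :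
  (forall x, `|T x| <= M * `|x|) -> ucompact K -> ucompact (T \o K).
Proof.
move=> TM cK I G UG u N uN; have /cvg_ex[y Ky] := cK _ _ UG _ _ uN.
by apply/cvg_ex; exists (T y); exact: bounded_cvg Ky.
Qed.

(** Homogeneity rescales a bounded family into the unit ball, whose image has compact closure. *)
Lemma compact_operator_ucompact K : (forall a x, K (a *: x) = a *: K x) ->
  compact_operator K -> ucompact K.
Proof.
rewrite /compact_operator precompactE => KZ cK I G UG u M uM.
pose N := Num.max M 1; have N0 : 0 < N by rewrite lt_max ltr01 orbT.
have [|p _ Kp] := @ultra_compact _ _ _ _ (fun i => K (N^-1 *: u i)) UG cK.
  apply: filterS uM => i uM; apply: subset_closure; exists (N^-1 *: u i) => //=.
  rewrite normrZ gtr0_norm ?invr_gt0// ler_pdivrMl// mulr1.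
  by rewrite (le_trans uM)// le_max lexx.
apply/cvg_ex; exists (N *: p).
rewrite (_ : (fun i => K (u i)) = fun i => N *: K (N^-1 *: u i)).
  exact: cvgZl_tmp.
by apply/funext => i; rewrite KZ scalerA divff ?scale1r// gt_eqF.
Qed.

(** The lower bound turns the Cauchy property of the images into that of [f], and [H] is
    complete. *)
Lemma bounded_below_cvg (Q : H -> H) (c : R) I (G : set_system I)
    (FG : ProperFilter G) (f : I -> H) : 0 < c ->
  (forall x y, c * `|x - y| <= `|Q x - Q y|) ->
  cvg (Q (f i) @[i --> G]) -> cvg (f i @[i --> G]).
Proof.
move=> c0 Qc /cvg_ex[y /cvgrPdist_lt Qy]; apply: cauchy_cvg.
apply: cauchy_exP => e e0.
have e2 : 0 < c * e / 2 by rewrite divr_gt0// mulr_gt0.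
have [i0 Gi0] := filter_ex (Qy _ e2); exists (f i0).
apply: filterS (Qy _ e2) => i Gi /=; rewrite -ball_normE /ball_ /=.
rewrite -(ltr_pM2l c0); apply: le_lt_trans (Qc _ _) _.
have -> : Q (f i0) - Q (f i) = (y - Q (f i)) - (y - Q (f i0)).
  by rewrite opprB [in RHS]addrC addrA subrK.
by apply: le_lt_trans (ler_normB _ _) _; lra.
Qed.

End Operators.

(** * Resolvents at the roots of unity *)

(** Multiplied by [2 sin t], [t = pi j / n], the sum telescopes to [sin (2 n t - t) + sin t], which
    is 0 because [2 n t = 2 pi j]; and [sin t > 0]. *)
Lemma sum_cos_roots (R : realType) (n j : nat) : (0 < j < n)%N ->
  \sum_(k < n) cos (j%:R * (2 * pi * k%:R / n%:R)) = 0 :> R.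
Proof.
move=> /andP[j0 jn]; have n0 : (0 : R) < n%:R by rewrite ltr0n (ltn_trans j0).
pose t : R := pi * j%:R / n%:R.
have sint : 0 < sin t.
  apply: sin_gt0_pi; rewrite divr_gt0 ?mulr_gt0 ?pi_gt0 ?(ltr0n _ j)//=.
  by rewrite ltr_pdivrMr// ltr_pM2l ?pi_gt0// ltr_nat.
have tele m : 2 * sin t * (\sum_(k < m) cos (j%:R * (2 * pi * k%:R / n%:R))) =
    sin (2 * m%:R * t - t) + sin t.
  elim: m => [|m IH]; first by rewrite big_ord0 !mulr0 mul0r sub0r sinN addNr.
  rewrite big_ord_recr /= mulrDr IH.
  have -> : j%:R * (2 * pi * m%:R / n%:R) = 2 * m%:R * t :> R.
    by rewrite /t; field; rewrite gt_eqF.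
  have -> : 2 * m.+1%:R * t - t = 2 * m%:R * t + t.
    by rewrite -natr1; ring.
  by rewrite sinB sinD; ring.
have /eqP := tele n; have -> : 2 * n%:R * t - t = - t + (pi *+ 2) *+ j.
  by rewrite -[_ *+ j]mulr_natl -[pi *+ 2]mulr_natl /t; field; rewrite gt_eqF.
rewrite (periodicn (@sinD2pi _)) sinN addNr mulf_eq0 => /orP[|/eqP//].
by rewrite mulf_eq0 pnatr_eq0 /= (gt_eqF sint).
Qed.

Section Resolvent.
Context {R : realType} {H : completeNormedModType R}.
Variables (ip : {dot H for idfun}) (ipE : hilbert_norm ip).
Implicit Types (T X : {linear H -> H}) (u v w x y z : H).

(** For [b = 2 s cos phi], [d = s^2] this is the real form of
    [(1 - s e^(i phi) T) (1 - s e^(-i phi) T)]. *)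
Definition quad (T : H -> H) (b d : R) v := v - b *: T v + d *: T (T v).

Lemma quadB T b d u v : quad T b d (u - v) = quad T b d u - quad T b d v.
Proof. by rewrite /quad !linearB /=; vring ipE. Qed.

Lemma quadD T b d u v : quad T b d (u + v) = quad T b d u + quad T b d v.
Proof. by rewrite /quad !linearD /=; vring ipE. Qed.

Lemma quadZ T b d a u : quad T b d (a *: u) = a *: quad T b d u.
Proof. by rewrite /quad !linearZ /=; vring ipE. Qed.

Lemma iter_linear T n : exists X : {linear H -> H}, iter n T = X :> (H -> H).
Proof.
elim: n => [|n [X IH]]; first by exists idfun.
by exists (T \o X : {linear H -> H}); apply/funext => v /=; rewrite -IH.
Qed.

Lemma iterZ (s : R) T n v : iter n (s \*: T) v = s ^+ n *: iter n T v.
Proof.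
elim: n => [|n IH]; first by rewrite expr0 scale1r.
by rewrite !iterS IH /= linearZ /= scalerA exprS.
Qed.

(* [(1 - X^n) (1 - cos phi X) = (1 - 2 cos phi X + X^2) sum_(j < n) cos (j phi) X^j]
   as soon as [n phi] is a multiple of [2 pi]. *)
Lemma quad_sum_cos X (phi : R) n w : (0 < n)%N ->
  quad X (2 * cos phi) 1 (\sum_(j < n) cos (j%:R * phi) *: iter j X w) =
  w - cos phi *: X w - cos (n%:R * phi) *: iter n X w
  + cos ((n%:R - 1) * phi) *: iter n.+1 X w.
Proof.
have c2 (m : nat) : cos (m.+1%:R * phi) =
    2 * cos phi * cos (m%:R * phi) - cos ((m%:R - 1) * phi).
  have -> : m.+1%:R * phi = m%:R * phi + phi by rewrite -natr1; ring.
  have -> : (m%:R - 1) * phi = m%:R * phi - phi by ring.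
  by rewrite cosD cosB; ring.
elim: n => // -[|n] IH _.
  rewrite big_ord_recl big_ord0 addr0 /= mul0r cos0 scale1r mul1r subrr mul0r.
  by rewrite cos0 /quad; vring ipE.
rewrite big_ord_recr quadD quadZ IH //= /quad.
rewrite (c2 n.+1).
have -> : (n.+2%:R - 1) * phi = n.+1%:R * phi by rewrite -natr1; ring.
by vring ipE.
Qed.

(** After exchanging the sums, [sum_cos_roots] kills every [j] except [j = 0]. *)
Lemma avg_sum_cos X n w : (0 < n)%N ->
  \sum_(k < n) \sum_(j < n)
    cos (j%:R * (2 * pi * k%:R / n%:R)) *: iter j X w = n%:R *: w.
Proof.
move=> n0; rewrite exchange_big /=.
rewrite -(big_mkord xpredT (fun j => \sum_(k < n)
    cos (j%:R * (2 * pi * k%:R / n%:R)) *: iter j X w)) big_ltn//.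
rewrite [X in X + _](_ : _ = n%:R *: w); last first.
  under eq_bigr do rewrite mul0r cos0 scale1r.
  by rewrite sumr_const card_ord scaler_nat.
rewrite big_nat_cond big1 ?addr0// => j; rewrite andbT => jn.
by rewrite -scaler_suml sum_cos_roots// scale0r.
Qed.

End Resolvent.

(** * A power of small norm from invertible quadratics *)

Section Rickart.
Context {R : realType} {H : completeNormedModType R}.
Variables (ip : {dot H for idfun}) (ipE : hilbert_norm ip).
Variables (T : {linear H -> H}) (t c : R).
Hypotheses (t0 : 0 <= t) (Tt : forall v, `|T v| <= t * `|v|) (c0 : 0 < c).
Hypothesis quad_ge : forall s a v, 0 <= s <= 1 -> `|a| <= 1 ->
  c * `|v| <= `|quad T (2 * s * a) (s ^+ 2) v|.
Hypothesis quad_onto : forall s a w, 0 <= s <= 1 -> `|a| <= 1 ->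
  exists v, quad T (2 * s * a) (s ^+ 2) v = w.
Implicit Types (s a : R) (u v w : H) (n : nat).

Let Q s a := quad T (2 * s * a) (s ^+ 2).
(** The inverse of [Q s a]: for parameters in range, [quad_onto] gives existence and [quad_ge]
    uniqueness. *)
Let Rv s a w : H := get [set v | Q s a v = w].

Let QR s a w : 0 <= s <= 1 -> `|a| <= 1 -> Q s a (Rv s a w) = w.
Proof.
move=> s01 a1; have [v Qv] := quad_onto w s01 a1.
by apply: (@getPex _ [set v | Q s a v = w]); exists v.
Qed.

Let Qinj s a u v : 0 <= s <= 1 -> `|a| <= 1 -> Q s a u = Q s a v -> u = v.
Proof.
move=> s01 a1 uv; apply/eqP; rewrite -subr_eq0 -normr_le0 -(pmulr_rle0 _ c0).
apply: le_trans (quad_ge _ s01 a1) _.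
by rewrite (quadB ipE) [quad _ _ _ u]uv subrr normr0.
Qed.

Let RB s a u v : 0 <= s <= 1 -> `|a| <= 1 ->
  Rv s a (u - v) = Rv s a u - Rv s a v.
Proof. by move=> s01 a1; apply: (Qinj s01 a1); rewrite /Q (quadB ipE) -/(Q s a) !QR. Qed.

Let R_le s a w : 0 <= s <= 1 -> `|a| <= 1 -> `|Rv s a w| <= c^-1 * `|w|.
Proof.
move=> s01 a1; rewrite mulrC ler_pdivlMr// mulrC.
by apply: le_trans (quad_ge _ s01 a1) _; rewrite -/(Q s a) QR.
Qed.

Let root (n k : nat) : R := cos (2 * pi * k%:R / n%:R).
Let root_le n k : `|root n k| <= 1.
Proof. by rewrite ler_norml cos_geN1 cos_le1. Qed.

(* The average over the n-th roots of unity [omega] of [(1 - omega s T)^-1],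
   which inverts [1 - s^n T^n]. *)
Let Y n s v := n%:R^-1 *: \sum_(k < n)
  Rv s (root n k) (v - (s * root n k) *: T v).

(** When [n phi] is a multiple of [2 pi], [quad_sum_cos] for [X = s T] has right-hand side
    [(1 - cos phi X) (1 - X^n) w]. Hence each resolvent term is a cosine sum, and these average to
    [w]. *)
Let YK n s w : (0 < n)%N -> 0 <= s <= 1 -> Y n s (w - s ^+ n *: iter n T w) = w.
Proof.
move=> n0 s01; rewrite /Y.
rewrite (eq_bigr (fun k : 'I_n => \sum_(j < n)
    cos (j%:R * (2 * pi * k%:R / n%:R)) *: iter j (s \*: T) w)).
  by rewrite (avg_sum_cos _ _ n0) scalerA mulVf ?scale1r// pnatr_eq0 -lt0n.
move=> k _; apply: (Qinj s01 (root_le n k)); rewrite QR ?root_le//.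
have n0' : n%:R != 0 :> R by rewrite pnatr_eq0 -lt0n.
have QX v : Q s (root n k) v = quad (s \*: T) (2 * root n k) 1 v.
  by rewrite /Q /quad /= !linearZ /=; vring ipE.
rewrite QX (quad_sum_cos ipE)//.
have -> : n%:R * (2 * pi * k%:R / n%:R) = 0 + (pi *+ 2) *+ k :> R.
  by rewrite -[_ *+ k]mulr_natl -[pi *+ 2]mulr_natl; field.
have -> : (n%:R - 1) * (2 * pi * k%:R / n%:R) =
    - (2 * pi * k%:R / n%:R) + (pi *+ 2) *+ k :> R.
  by rewrite -[_ *+ k]mulr_natl -[pi *+ 2]mulr_natl; field.
rewrite !(periodicn (@cosD2pi R)) cos0 cosN -/(root n k) !iterZ /=.
by rewrite (linearB T) [T (_ *: _)]linearZ exprS /=; vring ipE.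
Qed.

Let YB n s u v : 0 <= s <= 1 -> Y n s (u - v) = Y n s u - Y n s v.
Proof.
move=> s01; rewrite /Y -scalerBr -sumrB; congr (_ *: _); apply: eq_bigr => k _.
by rewrite -RB ?root_le//; congr (Rv _ _ _); rewrite linearB; vring ipE.
Qed.

Let mean_le n (f : 'I_n -> H) (M : R) : (0 < n)%N ->
  (forall k, `|f k| <= M) -> `|n%:R^-1 *: \sum_(k < n) f k| <= M.
Proof.
move=> n0 fM; rewrite normrZ ger0_norm ?invr_ge0// ler_pdivrMl ?ltr0n//.
apply: le_trans (ler_norm_sum _ _ _) _.
by apply: le_trans (ler_sum _ (fun k _ => fM k)) _; rewrite sumr_const card_ord mulr_natl.
Qed.

Let arg_le s a v : 0 <= s <= 1 -> `|a| <= 1 ->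
  `|v - (s * a) *: T v| <= (1 + t) * `|v|.
Proof.
move=> /andP[s0 s1] a1; apply: le_trans (ler_normB _ _) _.
rewrite mulrDl mul1r lerD2l normrZ normrM (ger0_norm s0).
apply: le_trans (_ : 1 * `|T v| <= _); last by rewrite mul1r.
by rewrite ler_wpM2r// mulr_ile1.
Qed.

(** Neither this bound nor the Lipschitz constant [L] below depends on [n], so the step length in
    [s] can be fixed before [n] is chosen. *)
Let L0 := c^-1 * (1 + t).
Let Y_le n s v : (0 < n)%N -> 0 <= s <= 1 -> `|Y n s v| <= L0 * `|v|.
Proof.
move=> n0 s01; apply: mean_le => // k.
apply: le_trans (R_le _ s01 (root_le n k)) _.
by rewrite /L0 -mulrA ler_wpM2l ?invr_ge0 ?(ltW c0)// arg_le// root_le.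
Qed.

Let L := c^-1 * (t + (2 * t + 2 * t ^+ 2) * L0).
(** Resolvent identity: [R' u' - R u = R' ((u' - u) - (Q' - Q) R u)], where [u' - u] and [Q' - Q]
    both carry a factor [s' - s]. *)
Let Y_lip n s s' v : (0 < n)%N -> 0 <= s <= 1 -> 0 <= s' <= 1 ->
  `|Y n s' v - Y n s v| <= L * `|s' - s| * `|v|.
Proof.
move=> n0 s01 s'01; rewrite /Y -scalerBr -sumrB; apply: mean_le => // k.
set a := root n k; have a1 : `|a| <= 1 := root_le n k.
set u' := v - (s' * a) *: T v; set u := v - (s * a) *: T v.
have -> : Rv s' a u' - Rv s a u =
    Rv s' a ((u' - u) - (Q s' a (Rv s a u) - Q s a (Rv s a u))).
  apply: (Qinj s'01 a1); rewrite [RHS]QR// /Q (quadB ipE) -/(Q s' a) -/(Q s a) !QR//.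
  by vring ipE.
apply: le_trans (R_le _ s'01 a1) _; rewrite /L -!mulrA ler_wpM2l//.
  by rewrite invr_ge0 ltW.
apply: le_trans (ler_normB _ _) _; rewrite mulrDl; apply: lerD.
  have -> : u' - u = ((s - s') * a) *: T v by rewrite /u' /u; vring ipE.
  rewrite normrZ normrM distrC mulrCA -mulrA ler_wpM2l//.
  apply: le_trans (_ : 1 * `|T v| <= _); first by rewrite ler_wpM2r.
  by rewrite mul1r.
set z := Rv s a u; have zv : `|z| <= L0 * `|v|.
  apply: le_trans (R_le _ s01 a1) _.
  by rewrite /L0 -mulrA ler_wpM2l ?invr_ge0 ?(ltW c0)// arg_le.
have -> : Q s' a z - Q s a z =
    (s' - s) *: (- (2 * a) *: T z + (s' + s) *: T (T z)).
  by rewrite /Q /quad; vring ipE.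
rewrite normrZ mulrCA ler_wpM2l//.
apply: (@le_trans _ _ ((2 * t + 2 * t ^+ 2) * `|z|)); last first.
  by rewrite -mulrA ler_wpM2l// addr_ge0 ?mulr_ge0 ?sqr_ge0.
apply: le_trans (ler_normD _ _) _; rewrite [leRHS]mulrDl; apply: lerD.
  rewrite normrZ normrN normrM ger0_norm// -!mulrA ler_wpM2l//.
  apply: le_trans (_ : 1 * `|T z| <= _); first by rewrite ler_wpM2r.
  by rewrite mul1r.
move: s01 s'01 => /andP[s0 s1] /andP[s'0 s'1].
rewrite normrZ ger0_norm ?addr_ge0// -mulrA; apply: ler_pM => //.
- by rewrite addr_ge0.
- by lra.
- by apply: le_trans (Tt _) _; rewrite expr2 -mulrA ler_wpM2l.
Qed.

Let small s := exists2 n, (0 < n)%N &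
  forall v, s ^+ n * `|iter n T v| <= 2^-1 * `|v|.

Let small_pow s m : 0 <= s -> small s -> exists2 n, (0 < n)%N &
  forall v, s ^+ n * `|iter n T v| <= 2^-1 ^+ m * `|v|.
Proof.
move=> s0 [n n0 sn]; elim: m => [|m [k k0 IH]].
  by exists n => // v; apply: le_trans (sn v) _; rewrite expr0 ler_wpM2r//; lra.
exists (n + k)%N; first by rewrite addn_gt0 n0.
move=> v; rewrite iterD exprD mulrAC.
apply: (@le_trans _ _ (2^-1 * `|iter k T v| * s ^+ k)).
  by rewrite ler_wpM2r// exprn_ge0.
by rewrite -mulrA exprS -mulrA ler_wpM2l// mulrC.
Qed.

(** For suitable [n], [Y n s] is within 1/8 of the identity and [Y n s'] within 1/8 of [Y n s]. As
    [Y n s'] maps [w = v - s'^n T^n v] to [v], this gives [|v - w| <= |w| / 4], hence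
    [|v - w| <= |v| / 3]. *)
Let small_step s s' : 0 <= s <= 1 -> 0 <= s' <= 1 -> L * `|s' - s| <= 8^-1 ->
  small s -> small s'.
Proof.
move=> s01 s'01 Lss ss.
have L00 : 0 <= L0 by rewrite /L0 mulr_ge0 ?invr_ge0 ?(ltW c0) ?addr_ge0.
have [m mL] : exists m, 8 * L0 <= 2 ^+ m.
  exists (Num.bound (8 * L0)); apply: ltW; exact: upper_nthrootP (leqnn _).
have [n n0 sn] := small_pow m (andP s01).1 ss; exists n => // v.
set w := v - s' ^+ n *: iter n T v.
have Yw : Y n s' w = v by exact: YK.
have Yw0 : `|Y n s w - w| <= 8^-1 * `|w|.
  have [X XE] := iter_linear T n.
  (* [Y n s w - w = Y n s (s^n T^n w)], of norm at most [L0 2^-m |w|]. *)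
  rewrite -{2}(YK w n0 s01) YB// opprB addrC subrK.
  apply: le_trans (Y_le _ n0 s01) _.
  rewrite normrZ ger0_norm ?exprn_ge0 ?(andP s01).1//.
  apply: (@le_trans _ _ (L0 * (2^-1 ^+ m * `|w|))); first by rewrite ler_wpM2l.
  rewrite mulrA ler_wpM2r// exprVn ler_pdivrMr ?exprn_gt0//.
  by rewrite ler_pdivlMl.
have Yw1 := Y_lip w n0 s01 s'01.
have {}Yw1 : `|Y n s' w - Y n s w| <= 8^-1 * `|w|.
  by apply: le_trans Yw1 _; rewrite ler_wpM2r.
have vw : `|v - w| <= 4^-1 * `|w|.
  rewrite -[X in X - w]Yw -[_ - w](subrKA (Y n s w)).
  by apply: le_trans (ler_normD _ _) _; lra.
have s'n : 0 <= s' ^+ n by rewrite exprn_ge0 ?(andP s'01).1.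
have E : v - w = s' ^+ n *: iter n T v by rewrite /w opprB addrC subrK.
have : `|w| <= `|v| + `|v - w| by rewrite -{1}[w](subKr v); exact: ler_normB.
move: vw; rewrite E normrZ (ger0_norm s'n); move: (s' ^+ n * _) => z.
by move: (normr_ge0 v); move: (`|w|) (`|v|) => p q; lra.
Qed.

(** [small] holds at [s = 0] and is carried to [s = 1] by [N] steps of length [1 / N], where
    [L / N <= 1/8]. *)
Lemma quad_spectral : exists2 n, (0 < n)%N &
  forall v, `|iter n T v| <= 2^-1 * `|v|.
Proof.
have L0_ge0 : 0 <= L0 by rewrite /L0 mulr_ge0 ?invr_ge0 ?(ltW c0) ?addr_ge0.
have L_ge0 : 0 <= L.
  rewrite /L mulr_ge0 ?invr_ge0 ?(ltW c0)// addr_ge0// mulr_ge0//.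
  by rewrite addr_ge0 ?mulr_ge0 ?sqr_ge0.
pose N := (Num.bound (8 * L)).+1.
have NL : 8 * L <= N%:R.
  have := archi_boundP (mulr_ge0 (ler0n R 8) L_ge0).
  by rewrite /N -natr1; lra.
have N0 : 0 < N%:R :> R by rewrite ltr0n.
have step j : (j <= N)%N -> small (j%:R / N%:R).
  elim: j => [_|j IH jN].
    rewrite mul0r; exists 1%N => // v.
    by rewrite expr1 mul0r mulr_ge0.
  have b i : (i <= N)%N -> 0 <= (i%:R / N%:R : R) <= 1.
    move=> iN; by rewrite divr_ge0//= ler_pdivrMr// mul1r ler_nat.
  apply: (small_step (b j (ltnW jN)) (b j.+1 jN)) (IH (ltnW jN)).
  rewrite -mulrBl -natr1 addrAC subrr add0r mul1r ger0_norm ?invr_ge0//.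
  by rewrite ler_pdivrMr// ler_pdivlMl.
have := step N (leqnn N); rewrite divff ?gt_eqF// => -[n n0 nT].
by exists n => // v; have := nT v; rewrite expr1n mul1r.
Qed.

End Rickart.

(** * Perturbation of a contraction by a compact map *)

Section EssentialNorm.
Context {R : realType} {H : completeNormedModType R}.
Variables (ip : {dot H for idfun}) (ipE : hilbert_norm ip).
Implicit Types (T : {linear H -> H}) (C : H -> H) (u v w x y z : H).

(** The essential norm is at most [q], witnessed by a map [C] outside the algebra and possibly
    nonlinear; hence the Lipschitz form of the bound. *)
Definition ess (q : R) (T : H -> H) := exists C : H -> H,
  [/\ C 0 = 0, forall u v, `|C u - C v| <= q * `|u - v|
    & ucompact (fun x => T x - C x)].

Lemma lip_bound (q : R) C : C 0 = 0 ->
  (forall u v, `|C u - C v| <= q * `|u - v|) -> forall v, `|C v| <= q * `|v|.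
Proof. by move=> C0 Cq v; have := Cq v 0; rewrite C0 !subr0. Qed.

(** [T^(n+1) - C^(n+1) = T (T^n - C^n) + (T - C) C^n]. *)
Lemma ess_iter T (t q : R) n : 0 <= q -> (forall v, `|T v| <= t * `|v|) ->
  ess q T -> ess (q ^+ n) (iter n T).
Proof.
move=> q0 Tt [C [C0 Cq cK]].
have iC0 m : iter m C 0 = 0 by elim: m => //= m ->.
have iCq m u v : `|iter m C u - iter m C v| <= q ^+ m * `|u - v|.
  elim: m u v => [|m IH] u v; first by rewrite expr0 mul1r.
  by rewrite !iterS; apply: le_trans (Cq _ _) _; rewrite exprS -mulrA ler_wpM2l.
exists (iter n C); split=> //.
elim: n => [|n IH].
  by move=> I G UG u M uM /=; under eq_fun do rewrite subrr; exact: is_cvg_cst.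
rewrite (_ : (fun x => _) = (fun x => (T \o (fun x => iter n T x - iter n C x)) x +
    ((fun x => T x - C x) \o iter n C) x)); last first.
  by apply/funext => x /=; rewrite linearB; vring ipE.
apply: ucompactD; first exact: ucompact_compl Tt IH.
exact: (ucompact_compr (lip_bound (iC0 n) (iCq n))).
Qed.

Lemma scale_cvg0 I (G : set_system I) (FG : Filter G) (s : I -> R) (f : I -> H)
    (M : R) : s i @[i --> G] --> (0 : R) -> (\forall i \near G, `|f i| <= M) ->
  s i *: f i @[i --> G] --> (0 : H).
Proof.
move=> s0 fM; apply/norm_cvg0P/cvgrPdist_le => e e0.
have d0 : 0 < e / (`|M| + 1) by rewrite divr_gt0// ltr_wpDl.
move/cvgrPdist_le : s0 => /(_ _ d0); apply: filterS2 fM => i fM.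
rewrite !sub0r !normrN normr_id => si; rewrite normrZ.
apply: (@le_trans _ _ (e / (`|M| + 1) * (`|M| + 1))); last first.
  by rewrite divfK// gt_eqF// ltr_wpDl.
rewrite ler_pM//; apply: le_trans fM _; apply: le_trans (ler_norm _) _.
by rewrite lerDl.
Qed.

Section Quarter.
Variables (T : {linear H -> H}) (t : R) (C : H -> H).
Hypotheses (Tt : forall v, `|T v| <= t * `|v|) (C0 : C 0 = 0)
  (Cq : forall u v, `|C u - C v| <= 4^-1 * `|u - v|)
  (cK : ucompact (fun x => T x - C x)).

Let E (b d : R) v := v - b *: C v + d *: C (C v).
Let K v := T v - C v.
Let K2 v := T (T v) - C (C v).

Let cK2 : ucompact K2.
Proof.
rewrite (_ : K2 = fun x => (T \o K) x + (K \o C) x); last first.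
  by apply/funext => x; rewrite /K2 /K /= linearB; vring ipE.
apply: ucompactD; first exact: ucompact_compl Tt cK.
exact: (ucompact_compr (lip_bound C0 Cq)).
Qed.

(** The correction terms lose at most [2/4 + 1/16] of [|u - v|]. *)
Let E_lower (b d : R) u v : `|b| <= 2 -> `|d| <= 1 ->
  4^-1 * `|u - v| <= `|E b d u - E b d v|.
Proof.
move=> b2 d1.
have -> : E b d u - E b d v =
    u - v - (b *: (C u - C v) - d *: (C (C u) - C (C v))) by rewrite /E; vring ipE.
apply: le_trans _ (lerB_dist _ _).
have h1 : `|b *: (C u - C v)| <= 2 * (4^-1 * `|u - v|).
  by rewrite normrZ ler_pM.
have h2 : `|d *: (C (C u) - C (C v))| <= 1 * (4^-1 * (4^-1 * `|u - v|)).
  rewrite normrZ ler_pM//; apply: le_trans (Cq _ _) _.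
  by rewrite ler_wpM2l// ?invr_ge0.
have := ler_normB (b *: (C u - C v)) (d *: (C (C u) - C (C v))).
by move: (normr_ge0 (u - v)); lra.
Qed.

Let EK (b d : R) v : E b d v = quad T b d v + (b *: K v - d *: K2 v).
Proof. by rewrite /E /quad /K /K2; vring ipE. Qed.

(** If the quadratic vanishes, [E b d] is the compact map [b K - d K2]; being bounded below, it
    makes the identity compact. *)
Lemma quad0_ucompact (b d : R) : `|b| <= 2 -> `|d| <= 1 ->
  (forall v, quad T b d v = 0) -> ucompact (id : H -> H).
Proof.
move=> b2 d1 Q0 I G UG u M uM; apply: (@bounded_below_cvg _ _ (E b d) 4^-1) => //.
  by move=> x y; exact: E_lower.
under eq_fun do rewrite EK Q0 add0r.
by apply: is_cvgB; apply: is_cvgZl_tmp; [exact: (cK UG uM)|exact: (cK2 UG uM)].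
Qed.

(** Otherwise there are unit vectors on which quadratics of varying parameters tend to 0. Parameters
    and vectors converge along an ultrafilter, and the limit is a unit vector in the kernel of the
    limiting quadratic. *)
Lemma quad_lower :
  (forall s a v, 0 <= s <= 1 -> `|a| <= 1 ->
    quad T (2 * s * a) (s ^+ 2) v = 0 -> v = 0) ->
  exists2 c, 0 < c & forall s a v, 0 <= s <= 1 -> `|a| <= 1 ->
    c * `|v| <= `|quad T (2 * s * a) (s ^+ 2) v|.
Proof.
move=> Qinj; apply: contrapT => Qc.
have /choice[f fP] : forall n : nat, exists p : R * R * H,
    [/\ 0 <= p.1.1 <= 1, `|p.1.2| <= 1, `|p.2| = 1 &
     `|quad T (2 * p.1.1 * p.1.2) (p.1.1 ^+ 2) p.2| < n.+1%:R^-1].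
  move=> n; apply: contrapT => Qn; apply: Qc; exists n.+1%:R^-1.
    by rewrite invr_gt0.
  move=> s a v s01 a1; rewrite leNgt; apply/negP => Qv; apply: Qn.
  have v0 : 0 < `|v|.
    rewrite normr_gt0; apply/eqP => v0; move: Qv.
    by rewrite v0 normr0 mulr0 ltNge normr_ge0.
  exists (s, a, `|v|^-1 *: v); split => //=.
    by rewrite normrZ ger0_norm ?invr_ge0// mulVf// gt_eqF.
  by rewrite (quadZ ipE) normrZ ger0_norm ?invr_ge0// ltr_pdivrMl// [ltRHS]mulrC.
have [G [UG Gle]] := ultraFilterLemma (@eventually_filter).
have [s s01 sl] : exists2 s : R, `[0, 1]%classic s & (f n).1.1 @[n --> G] --> s.
  apply: (ultra_compact UG (@segment_compact _ 0 1)); apply: nearW => n.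
  by rewrite /= in_itv /=; case: (fP n).
have [a a1 al] : exists2 a : R, `[-1, 1]%classic a & (f n).1.2 @[n --> G] --> a.
  apply: (ultra_compact UG (@segment_compact _ (-1) 1)); apply: nearW => n.
  by rewrite /= in_itv /= -ler_norml; case: (fP n).
move: s01 a1; rewrite /= !in_itv /= -ler_norml => s01 a1.
pose b n : R := 2 * (f n).1.1 * (f n).1.2; pose d n : R := (f n).1.1 ^+ 2.
have bl : b n @[n --> G] --> 2 * s * a.
  by apply: cvgM => //; apply: cvgM => //; exact: cvg_cst.
have dl : d n @[n --> G] --> s ^+ 2 by rewrite /d; apply: cvgM.
pose v n := (f n).2.
have v1 : \forall n \near G, `|v n| <= 1.
  by apply: nearW => n; rewrite le_eqVlt; case: (fP n) => _ _ -> _; rewrite eqxx.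
have Q0 : quad T (b n) (d n) (v n) @[n --> G] --> (0 : H).
  apply/norm_cvg0P/cvgrPdist_le => e e0.
  have Ge : \forall n \near G, n.+1%:R^-1 < e.
    by apply: Gle; exact: near_infty_natSinv_lt (PosNum e0).
  apply: filterS Ge => n ne; rewrite sub0r normrN normr_id ltW//.
  by apply: lt_trans ne; case: (fP n).
have b2 : `|2 * s * a| <= 2.
  case/andP: s01 => s0 s1; rewrite !normrM (ger0_norm s0) ger0_norm//.
  by rewrite -mulrA -[leRHS]mulr1 ler_pM2l// mulr_ile1.
have d1 : `|s ^+ 2| <= 1.
  by case/andP: s01 => s0 s1; rewrite ger0_norm ?sqr_ge0// exprn_ile1.
have /cvg_ex[l vl] : cvg (v n @[n --> G]).
  apply: (@bounded_below_cvg _ _ (E (2 * s * a) (s ^+ 2)) 4^-1) => //.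
    by move=> x y; exact: E_lower.
  (* At the limit parameters [E] is a null term, plus a term convergent by compactness, plus the
     effect of moving the parameters, which tends to 0. *)
  have -> : (fun n => E (2 * s * a) (s ^+ 2) (v n)) = fun n =>
      quad T (b n) (d n) (v n) + (b n *: K (v n) - d n *: K2 (v n)) +
      ((b n - 2 * s * a) *: C (v n) - (d n - s ^+ 2) *: C (C (v n))).
    by apply/funext => n; rewrite -EK /E; vring ipE.
  have Cv : \forall n \near G, `|C (v n)| <= 1.
    apply: filterS v1 => n vn; apply: le_trans (lip_bound C0 Cq _) _; lra.
  have CCv : \forall n \near G, `|C (C (v n))| <= 1.
    apply: filterS Cv => n vn; apply: le_trans (lip_bound C0 Cq _) _; lra.
  have bl0 : b n - 2 * s * a @[n --> G] --> (0 : R).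
    by rewrite -[0](subrr (2 * s * a)); apply: cvgB => //; exact: cvg_cst.
  have dl0 : d n - s ^+ 2 @[n --> G] --> (0 : R).
    by rewrite -[0](subrr (s ^+ 2)); apply: cvgB => //; exact: cvg_cst.
  apply: is_cvgD.
    apply: is_cvgD; first by apply/cvg_ex; exists 0.
    apply: is_cvgB; apply: is_cvgZ.
    - by apply/cvg_ex; exists (2 * s * a).
    - exact: (cK UG v1).
    - by apply/cvg_ex; exists (s ^+ 2).
    - exact: (cK2 UG v1).
  apply: is_cvgB; apply/cvg_ex; exists 0.
    exact: scale_cvg0 bl0 Cv.
  exact: scale_cvg0 dl0 CCv.
have l1 : `|l| = 1.
  have : `|v n| @[n --> G] --> `|l| by exact: cvg_norm.
  rewrite (_ : (fun n => `|v n|) = fun=> 1); last first.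
    by apply/funext => n; case: (fP n).
  by move=> l1; exact: (norm_cvg_unique l1 (cvg_cst _)).
have Tl : T (v n) @[n --> G] --> T l by exact: bounded_cvg vl.
have TTl : T (T (v n)) @[n --> G] --> T (T l) by exact: bounded_cvg Tl.
have Ql : quad T (b n) (d n) (v n) @[n --> G] --> quad T (2 * s * a) (s ^+ 2) l.
  by apply: cvgD; [apply: cvgB => //; exact: cvgZ|exact: cvgZ].
have l0 := Qinj _ _ _ s01 a1 (norm_cvg_unique Ql Q0).
by move: l1; rewrite l0 normr0 => /esym/eqP; rewrite oner_eq0.
Qed.

End Quarter.
End EssentialNorm.

(** * The algebra generated by the family *)

Section Algebra.
Context {R : realType} {H : completeNormedModType R}.
Variables (ip : {dot H for idfun}) (ipE : hilbert_norm ip).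
Variable F : set {linear H -> H}.
Hypothesis F_bounded : forall T : {linear H -> H}, F T -> bounded_operator T.
Hypothesis F_comm : forall T S : {linear H -> H}, F T -> F S -> T \o S = S \o T.
Hypothesis F_esa :
  forall T : {linear H -> H}, F T -> essentially_selfadjoint ip T.
Implicit Types (T S : H -> H) (u v w x y z : H).

(** Members are plain functions, closed under pointwise operations; [alg_linear] recovers linearity.
    The unit is [alg_scale 1]. *)
Inductive alg : (H -> H) -> Prop :=
| alg_gen (T : {linear H -> H}) : F T -> alg T
| alg_scale a : alg (fun x => a *: x)
| alg_add T S : alg T -> alg S -> alg (fun x => T x + S x)
| alg_comp T S : alg T -> alg S -> alg (T \o S).

Lemma alg_linear S : alg S -> exists X : {linear H -> H}, S = X.
Proof.
elim=> [T _|a|T U _ [X ->] _ [Y ->]|T U _ [X ->] _ [Y ->]].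
- by exists T.
- by exists (a \*: idfun).
- by exists (X \+ Y).
- by exists (X \o Y : {linear H -> H}).
Qed.

Lemma alg_bounded S : alg S ->
  exists2 M : R, 0 < M & forall x, `|S x| <= M * `|x|.
Proof.
elim=> [T FT|a|T U _ [M M0 TM] _ [N N0 UN]|T U _ [M M0 TM] _ [N N0 UN]].
- by have /linear_boundedP /pinfty_ex_gt0 := F_bounded FT.
- exists (`|a| + 1) => [|x]; first by rewrite ltr_wpDl.
  by rewrite normrZ ler_wpM2r// lerDl.
- exists (M + N) => [|x]; first by rewrite addr_gt0.
  by apply: le_trans (ler_normD _ _) _; rewrite mulrDl lerD.
- exists (M * N) => [|x]; first by rewrite mulr_gt0.
  by apply: le_trans (TM _) _; rewrite -mulrA ler_wpM2l// ltW.
Qed.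

Lemma alg_comm T S : alg T -> alg S -> forall x, T (S x) = S (T x).
Proof.
have gen (U : {linear H -> H}) V : F U -> alg V -> forall x, U (V x) = V (U x).
  move=> FU; elim=> [V' FV|a|V1 V2 _ h1 _ h2|V1 V2 _ h1 _ h2] x.
  - exact: (congr1 (@^~ x) (F_comm FU FV)).
  - exact: linearZ.
  - by rewrite linearD h1 h2.
  - by rewrite /= h1 h2.
move=> + aS; have [X SX] := alg_linear aS.
elim=> [U FU|a|V1 V2 _ h1 _ h2|V1 V2 _ h1 _ h2] x.
- exact: gen.
- by rewrite SX linearZ.
- by rewrite h1 h2 SX linearD.
- by rewrite /= h2 h1.
Qed.

(** [|T' y|^2 = (T T' y, y) <= M |T' y| |y|]. *)
Lemma adjoint_bounded T T' (M : R) : (forall x, `|T x| <= M * `|x|) ->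
  (forall x y, ip (T x) y = ip x (T' y)) -> forall y, `|T' y| <= M * `|y|.
Proof.
move=> TM TT' y; have [->|Ty0] := eqVneq (T' y) 0.
  by rewrite normr0; apply: le_trans (TM y).
have Ty : 0 < `|T' y| by rewrite normr_gt0.
rewrite -(ler_pM2l Ty) -expr2 ipE -TT'; apply: le_trans (ler_norm _) _.
apply: le_trans (cauchy_schwarz ipE _ _) _.
by rewrite mulrA [_ * M]mulrC ler_wpM2r.
Qed.

(** For a product, commutativity gives [U' T' - T U = (U' - U) T' + U (T' - T)], a sum of compact
    maps. *)
Lemma alg_adjoint S : alg S -> exists S',
  (forall x y, ip (S x) y = ip x (S' y)) /\ ucompact (fun x => S' x - S x).
Proof.
elim=> [T FT|a|T U aT [T' [TT' cT]] aU [U' [UU' cU]]|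
  T U aT [T' [TT' cT]] aU [U' [UU' cU]]].
- have TT' := adjointP ipE (F_bounded FT); exists (adjoint ip T); split=> //.
  apply: compact_operator_ucompact; last exact: F_esa.
  move=> a x; rewrite linearZ /= scalerBr; congr (_ - _).
  by apply: (ip_inj ipE) => z; rewrite -TT' !ipZr TT'.
- exists (fun x => a *: x); split=> [x y|]; first by rewrite ipZl ipZr.
  move=> I G UG u M uM; under eq_fun do rewrite subrr; exact: is_cvg_cst.
- exists (fun x => T' x + U' x); split=> [x y|]; first by rewrite ipDl TT' UU' ipDr.
  rewrite (_ : (fun x => _) = fun x => (T' x - T x) + (U' x - U x)).
    exact: ucompactD.
  by apply/funext => x; vring ipE.
- exists (U' \o T'); split=> [x y|]; first by rewrite /= TT' UU'.
  have [X UX] := alg_linear aU; have [M _ TM] := alg_bounded aT.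
  have [N _ UN] := alg_bounded aU.
  rewrite (_ : (fun x => _) = fun x => ((fun x => U' x - U x) \o T') x +
      (X \o (fun x => T' x - T x)) x).
    apply: ucompactD; first exact: ucompact_compr (adjoint_bounded TM TT') cU.
    by apply: ucompact_compl cT => x; rewrite -UX; exact: UN.
  by apply/funext => x /=; rewrite linearB /= -UX (alg_comm aU aT); vring ipE.
Qed.

Lemma alg_ext T S : alg T -> T =1 S -> alg S.
Proof. by move=> aT /funext <-. Qed.

Lemma alg_id : alg id.
Proof. by apply: (alg_ext (alg_scale 1)) => x; rewrite scale1r. Qed.

Lemma alg_scalel a T : alg T -> alg (fun x => a *: T x).
Proof. by move=> aT; exact: alg_comp (alg_scale a) aT. Qed.

Lemma alg_sub T S : alg T -> alg S -> alg (fun x => T x - S x).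
Proof.
move=> aT aS; apply: (alg_ext (alg_add aT (alg_scalel (-1) aS))) => x.
by rewrite scaleN1r.
Qed.

Lemma alg_quad T b d : alg T -> alg (quad T b d).
Proof.
move=> aT; apply: (alg_add (alg_sub alg_id (alg_scalel b aT))).
by apply: alg_scalel; exact: alg_comp.
Qed.

Lemma alg_iter T n : alg T -> alg (iter n T).
Proof. by move=> aT; elim: n => [|n IH]; [exact: alg_id|exact: alg_comp]. Qed.

Lemma ip_cvg I (G : set_system I) (FG : Filter G) (f : I -> H) y w :
  f i @[i --> G] --> y -> ip (f i) w @[i --> G] --> ip y w.
Proof.
move=> /cvgrPdist_lt fy; apply/cvgrPdist_lt => e e0.
have d0 : 0 < e / (`|w| + 1) by rewrite divr_gt0// ltr_wpDl.
apply: filterS (fy _ d0) => i yi; rewrite -ipNl -ipDl.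
apply: le_lt_trans (cauchy_schwarz ipE _ _) _.
apply: (@le_lt_trans _ _ (`|y - f i| * (`|w| + 1))); first by rewrite ler_wpM2l// lerDl.
by rewrite -ltr_pdivlMr ?ltr_wpDl.
Qed.

Lemma closed_orthogonal (P : set H) : closed [set x | forall w, P w -> ip x w = 0].
Proof.
have -> : [set x | forall w, P w -> ip x w = 0] =
    \bigcap_(w in P) [set x | ip x w = 0] by [].
apply: closed_bigI => w _.
apply: (@closed_comp _ _ (fun x => ip x w) [set 0 : R]) => [x _|]; last exact: closed_eq.
exact: ip_cvg.
Qed.

(** * Consequences of irreducibility *)

Section Transitive.
Hypothesis no_inv : forall L, ~ invariant_subspace F L.

(** Of the conditions defining an invariant subspace, only [L <> setT] can fail. *)
Lemma transitive_full (L : set H) : closed L -> L 0 ->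
  (forall a x y, L x -> L y -> L (a *: x + y)) ->
  (forall T, alg T -> forall x, L x -> L (T x)) ->
  forall z, L z -> z != 0 -> forall x, L x.
Proof.
move=> Lc L0 LD LT z Lz z0 x; apply: contrapT => Lx; apply: (no_inv (L := L)).
split => //.
- by split => [|a u v]; rewrite !inE//; exact: LD.
- by move=> LE; move: Lz; rewrite LE => /eqP; rewrite (negbTE z0).
- by move=> LE; apply: Lx; rewrite LE.
- by move=> T FT _ [u Lu <-]; apply: LT => //; exact: alg_gen.
Qed.

(** The kernel is stable by commutativity and closed as the orthogonal of the range of the
    adjoint. *)
Lemma alg_kernel S z : alg S -> S z = 0 -> z != 0 -> forall x, S x = 0.
Proof.
move=> aS Sz z0; have [S' [SS' _]] := alg_adjoint aS.
have [X SX] := alg_linear aS.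
apply: (@transitive_full [set x | S x = 0] _ _ _ _ z Sz z0).
- have -> : [set x | S x = 0] = [set x | forall w, range S' w -> ip x w = 0].
    apply/seteqP; split=> x /= => [Sx _ [w _ <-]|xw]; first by rewrite -SS' Sx ip0l.
    by apply: (ip_inj ipE) => w; rewrite ipC SS' xw ?ip0r//; exists w.
  exact: closed_orthogonal.
- by rewrite /= SX linear0.
- by move=> a x y /= Sx Sy; rewrite SX linearP -SX Sx Sy scaler0 addr0.
- by move=> T aT x /= Sx; have [Y TY] := alg_linear aT;
    rewrite (alg_comm aS aT) Sx TY linear0.
Qed.

(** The closure of the range is a closed subspace, stable by commutativity. *)
Lemma alg_range S z : alg S -> S z != 0 ->
  forall w (e : R), 0 < e -> exists v, `|w - S v| < e.
Proof.
move=> aS Sz0; have [X SX] := alg_linear aS.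
have := @transitive_full [set w | forall e : R, 0 < e -> exists v, `|w - S v| < e].
move=> /(_ _ _ _ _ (S z)); apply => //.
- move=> w cw e e0; have e2 : 0 < e / 2 by rewrite divr_gt0.
  have [y []] := cw _ (nbhsx_ballx w _ e2).
  move=> /(_ _ e2)[v yv]; rewrite -ball_normE /= => wy; exists v.
  have -> : w - S v = (w - y) + (y - S v) by rewrite addrA subrK.
  by apply: le_lt_trans (ler_normD _ _) _; lra.
- by move=> e e0; exists 0; rewrite SX linear0 subr0 normr0.
- move=> a x y Lx Ly e e0.
  have d0 : 0 < e / 2 / (`|a| + 1) by rewrite !divr_gt0// ltr_wpDl.
  have e2 : 0 < e / 2 by rewrite divr_gt0.
  have [u xu] := Lx _ d0; have [v yv] := Ly _ e2; exists (a *: u + v).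
  rewrite SX linearP -SX.
  have -> : a *: x + y - (a *: S u + S v) = a *: (x - S u) + (y - S v) by vring ipE.
  apply: le_lt_trans (ler_normD _ _) _; rewrite normrZ.
  have : `|a| * `|x - S u| <= e / 2.
    apply: (@le_trans _ _ ((`|a| + 1) * (e / 2 / (`|a| + 1)))).
      by rewrite ler_pM ?lerDl// ltW.
    by rewrite mulrC divfK// gt_eqF// ltr_wpDl.
  by move: yv; lra.
- move=> T aT x Lx e e0; have [M M0 TM] := alg_bounded aT.
  have [u xu] := Lx _ (divr_gt0 e0 M0); exists (T u).
  have [Y TY] := alg_linear aT; rewrite (alg_comm aS aT) TY -linearB -TY.
  by apply: le_lt_trans (TM _) _; rewrite mulrC -ltr_pdivlMr.
- by move=> e e0; exists z; rewrite subrr normr0.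
Qed.

(** The range is dense by [alg_range]; by the lower bound, approximate preimages converge. *)
Lemma bounded_below_onto S (c : R) : alg S -> 0 < c ->
  (forall v, c * `|v| <= `|S v|) -> forall w, exists v, S v = w.
Proof.
move=> aS c0 Sc w; have [X SX] := alg_linear aS; have [M M0 SM] := alg_bounded aS.
have [->|w0] := eqVneq w 0; first by exists 0; rewrite SX linear0.
have Sw : S w != 0.
  rewrite -normr_gt0; apply: lt_le_trans (Sc w).
  by rewrite mulr_gt0// normr_gt0.
have /choice[f fw] : forall n : nat, exists v, `|w - S v| < n.+1%:R^-1.
  by move=> n; apply: alg_range Sw _ _ _ => //; rewrite invr_gt0.
have Sf : S (f n) @[n --> \oo] --> w.
  apply/cvgrPdist_lt => e e0.
  have := near_infty_natSinv_lt (PosNum e0); apply: filterS => n /=.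
  by apply: lt_trans (fw n).
have /cvg_ex[l fl] : cvg (f n @[n --> \oo]).
  apply: (@bounded_below_cvg _ _ S c _ _ _ f c0); last exact: cvgP Sf.
  by move=> x y; rewrite SX -linearB -SX.
exists l; apply: (norm_cvg_unique _ Sf).
by rewrite SX; apply: bounded_cvg fl => x; rewrite -SX.
Qed.

(** If no quadratic vanishes, [alg_kernel] makes all of them injective, [quad_lower] bounds them
    below uniformly, and they are onto, so that [quad_spectral] applies. *)
Lemma ess_quarter T : alg T -> ess 4^-1 T ->
  (exists2 n, (0 < n)%N & forall v, `|iter n T v| <= 2^-1 * `|v|) \/
  (exists s a, [/\ 0 <= s <= 1, `|a| <= 1 &
    forall v, quad T (2 * s * a) (s ^+ 2) v = 0]).
Proof.
move=> aT [C [C0 Cq cK]].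
have [X TX] := alg_linear aT; have [M M0 TM] := alg_bounded aT.
have [[s [a [s01 a1 Q0]]]|Q] := pselect (exists s a, [/\ 0 <= s <= 1, `|a| <= 1 &
    forall v, quad T (2 * s * a) (s ^+ 2) v = 0]).
  by right; exists s, a.
left; rewrite TX in TM cK *.
have [|c c0 Xc] := quad_lower ipE TM C0 Cq cK.
  move=> s a v s01 a1 Qv; apply/eqP; apply: contrapT => /negP v0; apply: Q.
  exists s, a; split => //; apply: alg_kernel v0; first exact: alg_quad.
  by rewrite TX.
apply: (quad_spectral ipE (ltW M0) TM c0 Xc) => s a w s01 a1.
apply: (bounded_below_onto _ c0) => [|v]; last exact: Xc.
by rewrite -TX; exact: alg_quad.
Qed.

(** Some power has essential norm at most 1/4; a vanishing quadratic in it would make the identity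
    compact. *)
Lemma ess_lt1 T (q : R) : ~ ucompact (id : H -> H) -> alg T -> 0 <= q < 1 ->
  ess q T -> exists2 n, (0 < n)%N & forall v, `|iter n T v| <= 2^-1 * `|v|.
Proof.
move=> nc aT /andP[q0 q1] eT; have [X TX] := alg_linear aT.
have [M M0 TM] := alg_bounded aT.
have [k k0 qk] : exists2 k, (0 < k)%N & q ^+ k <= 4^-1.
  have q1' : `|q| < 1 by rewrite ger0_norm.
  have qi : 0 < 4^-1 :> R by [].
  have /cvgrPdist_le/(_ _ qi)[N _ NP] := cvg_expr q1'.
  exists N.+1 => //; have := NP N.+1 (leqnSn N).
  by rewrite /= sub0r normrN ger0_norm// exprn_ge0.
have eTk : ess 4^-1 (iter k T).
  rewrite TX in TM eT *.
  have [C [C0 Cq cK]] := ess_iter ipE k q0 TM eT; exists C; split => // u v.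
  by apply: le_trans (Cq _ _) _; rewrite ler_wpM2r.
have aTk := alg_iter k aT.
have [[n n0 Tn]|[s [a [s01 a1 Q0]]]] := ess_quarter aTk eTk.
  exists (n * k)%N; first by rewrite muln_gt0 n0.
  by move=> v; rewrite iterM.
case: nc; have [Y TY] := alg_linear aTk; have [N N0 TN] := alg_bounded aTk.
have [C [C0 Cq cK]] := eTk; rewrite TY in TN cK Q0.
apply: (quad0_ucompact ipE TN C0 Cq cK _ _ Q0).
  case/andP: s01 => s0 s1; rewrite !normrM (ger0_norm s0) ger0_norm//.
  by rewrite -mulrA -[leRHS]mulr1 ler_pM2l// mulr_ile1.
by case/andP: s01 => s0 s1; rewrite ger0_norm ?sqr_ge0// exprn_ile1.
Qed.

End Transitive.
End Algebra.

(** * Weak limits and dual cones *)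

Section Cone.
Context {R : realType} {H : completeNormedModType R}.
Variables (ip : {dot H for idfun}) (ipE : hilbert_norm ip).
Implicit Types (u v w x y z : H).

(** Two linear equations in three unknown coefficients. With [u = v = 0] it merely supplies a
    nonzero vector. *)
Lemma orthogonal2 u v : dim_ge H 3 ->
  exists w, [/\ w != 0, ip w u = 0 & ip w v = 0].
Proof.
move=> [e eP].
pose M : 'M[R]_(3, 2) := \matrix_(i, j) ip (e i) (if j == 0 then u else v).
have : kermx M != 0.
  by rewrite kermx_eq0 /row_free neq_ltn (leq_ltn_trans (rank_leq_col M)).
move=> /rowV0Pn[a /sub_kermxP aM a0].
have ipw y : ip (\sum_i a 0 i *: e i) y = \sum_i a 0 i * ip (e i) y.
  rewrite (big_morph (ip^~ y) (fun x z => ipDl ip x z y) (ip0l ip y)).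
  by apply: eq_bigr => i _; rewrite ipZl.
exists (\sum_i a 0 i *: e i); split.
- apply: contra_neq a0 => /eP a0; apply/rowP => i; rewrite mxE.
  exact: (a0 i).
- have := congr1 (fun A : 'rV_2 => A 0 0) aM; rewrite ipw !mxE => aM0.
  by rewrite -[RHS]aM0; apply: eq_bigr => i _; rewrite !mxE.
- have := congr1 (fun A : 'rV_2 => A 0 1) aM; rewrite ipw !mxE => aM0.
  by rewrite -[RHS]aM0; apply: eq_bigr => i _; rewrite !mxE.
Qed.

(** The limits of the scalar products form a bounded linear functional, represented by [riesz]. *)
Lemma weak_limit I (G : set_system I) (UG : UltraFilter G) (f : I -> H) (M : R) :
  (\forall i \near G, `|f i| <= M) ->
  exists x, forall z, ip (f i) z @[i --> G] --> ip x z.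
Proof.
move=> fM.
have /choice[l lP] : forall z, exists l : R,
    `[- (M * `|z|), M * `|z|]%classic l /\ ip (f i) z @[i --> G] --> l.
  move=> z.
  have [|l ? ?] := ultra_compact UG (@segment_compact R (- (M * `|z|)) (M * `|z|))
      (f := fun i => ip (f i) z); last by exists l.
  apply: filterS fM => i fM /=; rewrite in_itv /= -ler_norml.
  by apply: le_trans (cauchy_schwarz ipE _ _) _; rewrite ler_wpM2r.
have lE z a : ip (f i) z @[i --> G] --> a -> l z = a.
  by move=> za; exact: norm_cvg_unique (lP z).2 za.
have [|||x xl] := @riesz _ _ _ ipE l M.
- move=> y z; apply: lE; under eq_fun do rewrite ipDr.
  by apply: cvgD; [exact: (lP y).2|exact: (lP z).2].
- move=> a z; apply: lE; under eq_fun do rewrite ipZr.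
  by apply: cvgMl_tmp; exact: (lP z).2.
- by move=> z; have [] := lP z; rewrite /= in_itv /= -ler_norml.
- by exists x => z; rewrite ipC -xl; exact: (lP z).2.
Qed.

Lemma quadratic_ge0 (a b : R) : 0 <= b ->
  (forall t, 0 <= t <= 1 -> 0 <= 2 * t * a + t ^+ 2 * b) -> 0 <= a.
Proof.
move=> b0 ab; rewrite leNgt; apply/negP => a0.
have ba : 0 < b - a by lra.
(* The denominator [b - a] stays positive when [b = 0]. *)
have t01 : 0 <= - a / (b - a) <= 1.
  by rewrite divr_ge0 ?oppr_ge0 ?(ltW a0) ?(ltW ba)//= ler_pdivrMr// mul1r; lra.
have := ab _ t01.
have -> : 2 * (- a / (b - a)) * a + (- a / (b - a)) ^+ 2 * b =
    - (- a / (b - a)) * (- a + - a / (b - a) * - a).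
  by field; rewrite gt_eqF.
have t0 : 0 < - a / (b - a) by rewrite divr_gt0//; lra.
have na : 0 < - a by rewrite oppr_gt0.
by rewrite mulNr oppr_ge0 leNgt (mulr_gt0 t0)// (addr_gt0 na)// (mulr_gt0 t0).
Qed.

Definition dual (P : set H) : set H := [set c | forall p, P p -> 0 <= ip p c].

(** [p] is the point of least norm in [h + dual P], found as a weak limit of a minimizing sequence;
    the other properties are first-order conditions at this minimum. *)
Lemma moreau (P : set H) h : exists p c,
  [/\ h = p - c, dual P c, dual (dual P) p & ip p c = 0].
Proof.
have dual0 : dual P 0 by move=> p _; rewrite ip0r.
have dualD c c' t : dual P c -> dual P c' -> 0 <= t -> dual P (c + t *: c').
  by move=> Pc Pc' t0 p Pp; rewrite ipDr ipZr addr_ge0 ?mulr_ge0 ?Pc ?Pc'.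
pose D := [set `|h + c| | c in dual P].
have Dinf : has_inf D.
  by split; [exists `|h + 0|, 0|exists 0 => _ [c _ <-]].
have /choice[f fP] : forall n : nat, exists c,
    dual P c /\ `|h + c| < inf D + n.+1%:R^-1.
  move=> n; have [|_ [c Pc <-] ?] := inf_adherent _ Dinf (eps := n.+1%:R^-1).
    by rewrite invr_gt0.
  by exists c.
have [G [UG Gle]] := ultraFilterLemma (@eventually_filter).
have f_le n : `|h + f n| <= inf D + 1.
  apply: ltW; apply: lt_le_trans (fP n).2 _; rewrite lerD2l invf_le1 ?ler1n//.
have [q qlim] : exists q, forall z, ip (h + f n) z @[n --> G] --> ip q z.
  by apply: (weak_limit UG (M := inf D + 1)); exact: nearW.
pose c := q - h.
have Pc : dual P c.
  move=> p Pp; have : ip (f n) p @[n --> G] --> ip c p.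
    rewrite /c ipDl ipNl; under eq_fun => n.
      rewrite (_ : ip (f n) p = ip (h + f n) p - ip h p); last first.
        by rewrite ipDl addrAC subrr add0r.
      over.
    by apply: cvgB; [exact: qlim|exact: cvg_cst].
  rewrite (ipC _ p) => cl; apply: (closed_cvg _ (@closed_ge _ (0 : R)) _ _ cl).
  by apply: nearW => n; rewrite ipC; exact: (fP n).1.
(* Weak lower semicontinuity of the norm: [|q|^2] is the limit of [(h + f n, q)]. *)
have q_le : `|q| <= inf D.
  apply/ler_addgt0Pr => e e0; have [->|q0] := eqVneq q 0.
    rewrite normr0 addr_ge0 ?(ltW e0)//; apply: lb_le_inf; first exact: Dinf.1.
    by move=> _ [? _ <-].
  rewrite -(ler_pM2r (_ : 0 < `|q|)) ?normr_gt0// -expr2 ipE.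
  apply: (closed_cvg _ (@closed_le _ ((inf D + e) * `|q|)) _ _ (qlim q)).
  have Ge : \forall n \near G, n.+1%:R^-1 < e.
    by apply: Gle; exact: near_infty_natSinv_lt (PosNum e0).
  apply: filterS Ge => n ne; apply: le_trans (ler_norm _) _.
  apply: le_trans (cauchy_schwarz ipE _ _) _; rewrite ler_wpM2r//.
  by apply: le_trans (ltW (fP n).2) _; rewrite lerD2l ltW.
have q_min c' : dual P c' -> ip q q <= ip (h + c') (h + c').
  move=> Pc'; rewrite -!ipE ler_sqr ?nnegrE//; apply: le_trans q_le _.
  by apply: ge_inf; [exact: Dinf.2|exists c'].
have qcE : q = h + c by rewrite /c addrC subrK.
(* Used for [d] in the dual cone, and for [c] and [- c]; the segment from [c] to 0 stays in the
   cone. *)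
have dir d : (forall t, 0 <= t <= 1 -> dual P (c + t *: d)) -> 0 <= ip q d.
  move=> Pd; apply: (quadratic_ge0 (b := ip d d)); first by rewrite -ipE sqr_ge0.
  move=> t /Pd /q_min; rewrite addrA -qcE !(ipDl, ipDr, ipZl, ipZr) (ipC ip d q).
  by rewrite expr2; lra.
exists q, c; split => //.
- by rewrite qcE addrK.
- by move=> d Pd; rewrite ipC; apply: dir => t /andP[t0 _]; exact: dualD.
- apply/le_anti/andP; split; last first.
    by apply: dir => t /andP[t0 _]; exact: dualD.
  rewrite -oppr_ge0 -ipNr; apply: dir => t /andP[_ t1].
  have -> : c + t *: - c = 0 + (1 - t) *: c by rewrite add0r scalerBl scale1r scalerN.
  by apply: dualD => //; rewrite subr_ge0.
Qed.

End Cone.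

(** * Negative values of squares *)

Section Positivity.
Context {R : realType} {H : completeNormedModType R}.
Variables (ip : {dot H for idfun}) (ipE : hilbert_norm ip).
Hypothesis dimH : dim_ge H 3.
Variable F : set {linear H -> H}.
Hypothesis F_bounded : forall T : {linear H -> H}, F T -> bounded_operator T.
Hypothesis F_comm : forall T S : {linear H -> H}, F T -> F S -> T \o S = S \o T.
Hypothesis F_esa :
  forall T : {linear H -> H}, F T -> essentially_selfadjoint ip T.
Hypothesis no_inv : forall L, ~ invariant_subspace F L.
Implicit Types (T S : H -> H) (u v w x y z : H).

Local Notation alg := (alg F).
Let adj S (aS : alg S) := alg_adjoint ipE F_bounded F_comm F_esa aS.
Let acomm S T (aS : alg S) (aT : alg T) := alg_comm F_comm aS aT.

(** The [z] with [(S z, y) = 0] for all [S] form a closed stable subspace. If [x] is nonzero it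
    contains [y], and [S = 1] gives [|y|^2 = 0]. *)
Lemma dense_orbit x y : (forall S, alg S -> ip (S x) y = 0) -> x = 0 \/ y = 0.
Proof.
move=> Sxy; have [->|x0] := eqVneq x 0; [by left|right].
pose P := [set w | exists2 S, alg S & forall z, ip (S z) y = ip z w].
have PE z : (forall w, P w -> ip z w = 0) <-> (forall S, alg S -> ip (S z) y = 0).
  split=> [zP S aS|zS w [S aS Sw]]; last by rewrite -Sw zS.
  have [S' [SS' _]] := adj aS; rewrite SS' zP//; exists S => // ?; exact: SS'.
have /PE/(_ _ (alg_id _)) : forall w, P w -> ip y w = 0.
  apply: (@transitive_full _ _ _ no_inv [set z | forall w, P w -> ip z w = 0]
    _ _ _ _ x _ x0 y) => /=.
  - exact: closed_orthogonal.
  - by move=> w _; exact: ip0l.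
  - by move=> a u v Pu Pv w Pw; rewrite ipDl ipZl Pu// Pv// mulr0 addr0.
  - move=> T aT z /PE zP; apply/PE => S aS.
    by rewrite -(zP (S \o T))//; exact: alg_comp.
  - exact/PE.
by rewrite -ipE => /eqP; rewrite expf_eq0 /= normr_eq0 => /eqP.
Qed.

(* By Moreau, H is the union of the cone P generated by the S^2 x, made closed by
   passing to the bidual, and of the opposite of its dual cone C: in a
   decomposition h = p - c with p orthogonal to c, the form (S S' p, c) is
   positive semidefinite on the algebra and vanishes at 1, so it vanishes by
   Cauchy-Schwarz. A vector orthogonal to a nonzero element of P and a nonzero
   element of C then yields a contradiction. *)
Lemma square_negative x y : x != 0 -> y != 0 ->
  exists2 S, alg S & ip (S (S x)) y < 0.
Proof.
move=> x0 y0; apply: contrapT => xy.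
pose P := [set z | exists2 S, alg S & z = S (S x)].
have Py : dual ip P y.
  move=> _ [S aS ->]; rewrite leNgt; apply/negP => Sxy; apply: xy.
  by exists S.
have Px : dual ip (dual ip P) x.
  by move=> c Pc; rewrite ipC; apply: Pc; exists id => //; exact: alg_id.
have ortho p c : dual ip (dual ip P) p -> dual ip P c -> ip p c = 0 -> p = 0 \/ c = 0.
  move=> Pp Pc pc; apply: dense_orbit => S aS.
  (* [T'^2 c] is in the dual cone because [T^2 N^2 = (T N)^2]. *)
  have sq T : alg T -> 0 <= ip (T (T p)) c.
    move=> aT; have [T' [TT' _]] := adj aT.
    rewrite !TT' ipC; apply: Pp => _ [N aN ->].
    rewrite -!TT'; apply: Pc; exists (T \o N); first exact: alg_comp.
    by rewrite /= (acomm aN aT).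
  (* Apply [sq] to [t + S]: as [(p, c) = 0], the result is affine in [t], so its slope must
     vanish. *)
  have aff t : 0 <= 2 * t * ip (S p) c + ip (S (S p)) c.
    have [X SX] := alg_linear aS.
    have := sq _ (alg_add (alg_scale F t) aS).
    by rewrite SX (linearD X) [X (_ *: _)]linearZ /= !(ipDl, ipZl) pc; lra.
  apply: contrapT => /eqP Sp0.
  (* At this [t] the affine function equals -1. *)
  have := aff (- (ip (S (S p)) c + 1) / (2 * ip (S p) c)).
  rewrite (_ : 2 * _ * _ = - (ip (S (S p)) c + 1)); last by field.
  by lra.
have [z [z0 zx zy]] := orthogonal2 ip x y dimH.
have [p [c [zE Pc Pp pc]]] := moreau ipE P z.
case: (ortho _ _ Pp Pc pc) => [p0|c0].
- have xc : ip x c = 0.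
    by rewrite -[c]opprK -[- c]add0r -p0 -zE ipNr ipC zx oppr0.
  case: (ortho _ _ Px Pc xc) => [/eqP|c0]; first by rewrite (negbTE x0).
  by move: z0; rewrite zE p0 c0 subr0 eqxx.
- have py : ip p y = 0 by rewrite -[p]subr0 -c0 -zE.
  case: (ortho _ _ Pp Py py) => [p0|/eqP]; last by rewrite (negbTE y0).
  by move: z0; rewrite zE p0 c0 subr0 eqxx.
Qed.

End Positivity.

(** * Products of commuting operators *)

Section Words.
Context {R : realType} {H : completeNormedModType R}.
Variable F : set {linear H -> H}.
Hypothesis F_bounded : forall T : {linear H -> H}, F T -> bounded_operator T.
Hypothesis F_comm : forall T S : {linear H -> H}, F T -> F S -> T \o S = S \o T.
Implicit Types (T S W : H -> H) (Ts : seq (H -> H)) (x v : H).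

Definition contracting T := alg F T /\
  exists2 n, (0 < n)%N & forall v, `|iter n T v| <= 2^-1 * `|v|.

Inductive word Ts : nat -> (H -> H) -> Prop :=
| word0 : word Ts 0 id
| wordS T k W : List.In T Ts -> word Ts k W -> word Ts k.+1 (T \o W).

(** With [k = q n + r], [T^(q n)] contributes [2^-q] and [T^r] at most [(M + 1)^n]. *)
Lemma iter_decay T : contracting T ->
  (exists2 M : R, 0 < M & forall k v, `|iter k T v| <= M * `|v|) /\
  (forall e : R, 0 < e -> exists N, forall k v, (N <= k)%N -> `|iter k T v| <= e * `|v|).
Proof.
move=> [aT [n n0 Tn]]; have [M M0 TM] := alg_bounded F_bounded aT.
pose B := (M + 1) ^+ n; have B0 : 0 < B by rewrite exprn_gt0// addr_gt0.
have rem r v : (r < n)%N -> `|iter r T v| <= B * `|v|.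
  move=> rn; apply: (@le_trans _ _ ((M + 1) ^+ r * `|v|)); last first.
    by rewrite ler_wpM2r// ler_weXn2l ?(ltnW rn)// lerDr ltW.
  elim: r {rn} => [|r IH]; first by rewrite expr0 mul1r.
  rewrite iterS exprS -mulrA; apply: le_trans (TM _) _.
  by apply: ler_pM => //; rewrite ?(ltW M0)// lerDl.
have quo q v : `|iter (q * n) T v| <= 2^-1 ^+ q * `|v|.
  elim: q => [|q IH]; first by rewrite mul0n mul1r.
  rewrite mulSn iterD exprS -mulrA; apply: le_trans (Tn _) _.
  by rewrite ler_wpM2l.
have both k v : `|iter k T v| <= 2^-1 ^+ (k %/ n) * (B * `|v|).
  rewrite {1}(divn_eq k n) iterD; apply: le_trans (quo _ _) _.
  by rewrite ler_wpM2l// rem// ltn_mod.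
split.
  exists B => // k v; apply: le_trans (both k v) _.
  by rewrite ler_piMl ?mulr_ge0 ?(ltW B0)// exprn_ile1//; lra.
move=> e e0; have h1 : `|2^-1 : R| < 1 by rewrite ger0_norm//; lra.
have /cvgrPdist_le/(_ _ (divr_gt0 e0 B0))[q _ qP] := cvg_expr h1.
exists (q * n)%N => k v qk; apply: le_trans (both k v) _.
rewrite mulrA ler_wpM2r// -ler_pdivlMr//.
have := qP (k %/ n)%N; rewrite /= leq_divRL// => /(_ qk).
by rewrite sub0r normrN ger0_norm// exprn_ge0.
Qed.

(** Commutativity collects the occurrences of the head: [W = T^a W']. Both factors are bounded, and
    in a long word one of them is long, hence small. *)
Lemma word_decay Ts : (forall T, List.In T Ts -> contracting T) ->
  (exists2 M : R, 0 < M & forall k W v, word Ts k W -> `|W v| <= M * `|v|) /\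
  (forall e : R, 0 < e ->
    exists N, forall k W v, word Ts k W -> (N <= k)%N -> `|W v| <= e * `|v|).
Proof.
elim: Ts => [|T Ts IH] TsP.
  split; first by exists 1 => // k W v []; rewrite ?mul1r.
  by move=> e e0; exists 1%N => k W v [].
have [[M1 M10 M1P] T0] := iter_decay (TsP T (or_introl erefl)).
have [[M2 M20 M2P] Ts0] := IH (fun S TsS => TsP S (or_intror TsS)).
have split k W : word (T :: Ts) k W -> exists a b W',
    [/\ k = (a + b)%N, word Ts b W' & forall v, W v = iter a T (W' v)].
  elim=> [|S {}k {}W [<-|TsS] _ [a [b [W' [-> wW' WE]]]]].
  - by exists 0%N, 0%N, id; split => //; exact: word0.
  - by exists a.+1, b, W'; split => // v /=; rewrite WE.
  - exists a, b.+1, (S \o W'); split; [by rewrite addnS|exact: wordS|].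
    move=> v /=; rewrite WE; have aS := (TsP S (or_intror TsS)).1.
    by rewrite (alg_comm F_comm aS (alg_iter a (TsP T (or_introl erefl)).1)).
split.
  exists (M1 * M2) => [|k W v /split[a [b [W' [_ wW' ->]]]]]; first exact: mulr_gt0.
  apply: le_trans (M1P _ _) _; rewrite -mulrA ler_wpM2l ?(ltW M10)//.
  exact: M2P wW'.
move=> e e0; have [N1 N1P] := T0 _ (divr_gt0 e0 M20).
have [N2 N2P] := Ts0 _ (divr_gt0 e0 M10).
exists (N1 + N2)%N => k W v /split[a [b [W' [-> wW' ->]]]] Nab.
have [N1a|aN1] := leqP N1 a.
  apply: le_trans (N1P _ _ N1a) _.
  apply: (@le_trans _ _ (e / M2 * (M2 * `|v|))).
    by rewrite ler_wpM2l ?divr_ge0 ?(ltW e0) ?(ltW M20)//; exact: M2P wW'.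
  by rewrite mulrA divfK// gt_eqF.
have N2b : (N2 <= b)%N.
  by rewrite -(leq_add2l N1) (leq_trans Nab)// leq_add2r ltnW.
apply: le_trans (M1P _ _) _; have := N2P _ _ v wW' N2b.
by rewrite -(ler_pM2l M10) [leRHS]mulrA [M1 * (e / M1)]mulrC divfK ?gt_eqF.
Qed.

(** Staying in [U] produces arbitrarily long words [W] with [|W x| >= m], against [word_decay]. *)
Lemma no_trapping Ts (U : set H) (m : R) x :
  (forall T, List.In T Ts -> contracting T) -> 0 < m ->
  (forall v, U v -> m <= `|v|) -> U x ->
  ~ forall v, U v -> exists2 T, List.In T Ts & U (T v).
Proof.
move=> TsP m0 Um Ux trap.
have [k kP] : exists N, forall k W, word Ts k W -> (N <= k)%N -> `|W x| < m.
  have [_ dec] := word_decay TsP.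
  have x1 : 0 < `|x| + 1 by rewrite ltr_wpDl.
  have [N NP] := dec _ (divr_gt0 m0 x1); exists N => k W wW Nk.
  apply: le_lt_trans (NP _ _ x wW Nk) _.
  by rewrite mulrAC ltr_pdivrMr// ltr_pM2l// ltrDl.
have [W wW UW] : exists2 W, word Ts k W & U (W x).
  elim: k {kP} => [|k [W wW UW]]; first by exists id => //; exact: word0.
  by have [T TsT UT] := trap _ UW; exists (T \o W) => //; exact: wordS.
by have := kP _ _ wW (leqnn k); rewrite ltNge Um.
Qed.

End Words.

(** * The infinite-dimensional case *)

Section Irreducible.
Context {R : realType} {H : completeNormedModType R}.
Variables (ip : {dot H for idfun}) (ipE : hilbert_norm ip).
Hypothesis dimH : dim_ge H 3.
Variable F : set {linear H -> H}.
Hypothesis F_bounded : forall T : {linear H -> H}, F T -> bounded_operator T.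
Hypothesis F_comm : forall T S : {linear H -> H}, F T -> F S -> T \o S = S \o T.
Hypothesis F_esa :
  forall T : {linear H -> H}, F T -> essentially_selfadjoint ip T.
Hypothesis no_inv : forall L, ~ invariant_subspace F L.
Implicit Types (T S : H -> H) (u v w x y z : H).

Local Notation alg := (alg F).
Let adj S (aS : alg S) := alg_adjoint ipE F_bounded F_comm F_esa aS.
Let acomm S T (aS : alg S) (aT : alg T) := alg_comm F_comm aS aT.

(** * Hilden's argument on a ball *)

Section Ball.
Variables (x0 : H) (r : R).
Hypothesis r0 : 0 < r.

Let U x := `|x - x0| <= r.
(** Half the derivative of [|x - x0|^2] in the direction [- S^2 x]: a negative value moves [x]
    towards [x0]. *)
Let f S x := ip (S (S x)) (x0 - x).
(** Affine, hence weakly continuous; on the sphere [|x - x0| = r] it equals [(x, x0 - x)]. *)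
Let g x := ip x0 (x0 - x) - r ^+ 2.
Let B := r + `|x0|.

Let U_le x : U x -> `|x| <= B.
Proof.
move=> Ux; rewrite -[x](subrK x0); apply: le_trans (ler_normD _ _) _.
by rewrite lerD2r.
Qed.

Let B_ge0 : 0 <= B. Proof. by rewrite addr_ge0// ltW. Qed.

Let ip_le x : U x -> `|ip x (x0 - x)| <= B * r.
Proof.
move=> Ux; apply: le_trans (cauchy_schwarz ipE _ _) _.
by rewrite ler_pM// ?U_le// distrC.
Qed.

Let U_sqr x : U x <-> ip (x - x0) (x - x0) <= r ^+ 2.
Proof. by rewrite -ipE ler_sqr ?nnegrE// ltW. Qed.

Lemma radial_step (n : R) : 0 < n -> exists T q,
  [/\ alg T, 0 <= q < 1, ess q T & forall x, U x -> g x <= - n -> U (T x)].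
Proof.
(* Chosen so that [2 e <= 1] and [e B^2 <= n]. *)
move=> n0; pose e := (2 + B ^+ 2 / n)^-1.
have D0 : 0 < 2 + B ^+ 2 / n by rewrite ltr_wpDr// divr_ge0 ?sqr_ge0// ltW.
have e0 : 0 < e by rewrite invr_gt0.
have eD : e * 2 + e * (B ^+ 2 / n) = 1 by rewrite -mulrDr mulVf// gt_eqF.
have eB : 0 <= e * (B ^+ 2 / n) by rewrite mulr_ge0 ?divr_ge0 ?sqr_ge0// ltW.
have eBn : e * B ^+ 2 <= n.
  have : e * (B ^+ 2 / n) <= 1 by lra.
  by rewrite mulrA ler_pdivrMr// mul1r.
exists (fun x => (1 - e) *: x), (1 - e); split.
- exact: alg_scale.
- by apply/andP; split; lra.
- exists (fun x => (1 - e) *: x); split; first by rewrite scaler0.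
    by move=> u v; rewrite -scalerBr normrZ ger0_norm//; lra.
  by move=> I G UG u M uM; under eq_fun do rewrite subrr; exact: is_cvg_cst.
move=> x Ux; rewrite /g => gx; apply/U_sqr.
have xx : ip x x <= B ^+ 2 by rewrite -ipE ler_sqr ?nnegrE ?U_le.
have d : ip (x - x0) (x - x0) <= r ^+ 2 by apply/U_sqr.
have -> : ip ((1 - e) *: x - x0) ((1 - e) *: x - x0) =
    (1 - 2 * e) * ip (x - x0) (x - x0) +
    2 * e * ip x0 (x0 - x) + e * (e * ip x x).
  rewrite !(ipDl, ipDr, ipNl, ipNr, ipZl, ipZr) (ipC ip x0 x); ring.
have h1 : (1 - 2 * e) * ip (x - x0) (x - x0) <= (1 - 2 * e) * r ^+ 2.
  by rewrite ler_wpM2l//; lra.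
have h2 : 2 * e * ip x0 (x0 - x) <= 2 * e * (r ^+ 2 - n).
  by rewrite ler_wpM2l ?mulr_ge0 ?(ltW e0)//; lra.
have h3 : e * (e * ip x x) <= e * n.
  by rewrite ler_wpM2l ?(ltW e0)//; apply: le_trans eBn; rewrite ler_wpM2l// ltW.
by have := mulr_gt0 e0 n0; lra.
Qed.

(* [1 - e (S^2 + th)] differs from [(1 - e th) - e S^* S], which has norm at most
   [1 - e th], by a compact operator. *)
Lemma square_step S (n : R) : alg S -> 0 < n -> exists T q,
  [/\ alg T, 0 <= q < 1, ess q T & forall x, U x -> f S x <= - n -> U (T x)].
Proof.
move=> aS n0; have [S' [SS' cS]] := adj aS.
have [M M0 SM] := alg_bounded F_bounded aS; have S'M := adjoint_bounded ipE SM SS'.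
have [X SX] := alg_linear aS.
(* The shift makes the essential norm less than 1 and costs at most half of the margin [n]. *)
pose th := n / (2 * (B * r + 1)).
have Br0 : 0 <= B * r by rewrite mulr_ge0// ltW.
have th0 : 0 < th by rewrite divr_gt0// mulr_gt0// ltr_wpDl.
have thB : th * (B * r) <= n / 2.
  have : th * (2 * (B * r + 1)) = n by rewrite divfK// gt_eqF// mulr_gt0// ltr_wpDl.
  by lra.
pose N x := S (S x) + th *: x.
pose W := (M ^+ 2 + th) * B.
have W0 : 0 <= W by rewrite mulr_ge0// addr_ge0 ?sqr_ge0 ?ltW.
have NW x : U x -> `|N x| <= W.
  move=> Ux; apply: le_trans (ler_normD _ _) _; rewrite /W mulrDl.
  apply: lerD.
    apply: le_trans (SM _) _; rewrite expr2 -mulrA ler_wpM2l ?(ltW M0)//.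
    by apply: le_trans (SM _) _; rewrite ler_wpM2l ?(ltW M0)// U_le.
  by rewrite normrZ gtr0_norm// ler_wpM2l ?(ltW th0)// U_le.
(* The summands ensure [e W^2 <= n], [2 e th <= 1] and [e M^2 <= 2 (1 - e th)]. *)
pose D := W ^+ 2 / n + 2 * th + M ^+ 2 + 1.
have Wn0 : 0 <= W ^+ 2 / n by rewrite divr_ge0 ?sqr_ge0// ltW.
have D0 : 0 < D by have := sqr_ge0 M; rewrite /D; lra.
pose e := D^-1; have e0 : 0 < e by rewrite invr_gt0.
have eD : e * (W ^+ 2 / n) + 2 * (e * th) + e * M ^+ 2 + e = 1.
  rewrite -[RHS](mulVf (_ : D != 0)) ?gt_eqF// -/e /D; ring.
have eW0 : 0 <= e * (W ^+ 2 / n) by rewrite mulr_ge0// ltW.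
have eth0 : 0 < e * th by rewrite mulr_gt0.
have eM0 : 0 <= e * M ^+ 2 by rewrite mulr_ge0 ?sqr_ge0// ltW.
have eW : e * W ^+ 2 <= n.
  have : e * (W ^+ 2 / n) <= 1 by lra.
  by rewrite mulrA ler_pdivrMr// mul1r.
exists (fun x => x - e *: N x), (1 - e * th); split.
- apply: alg_sub; first exact: alg_id.
  apply: alg_scalel; apply: alg_add; [exact: alg_comp|exact: alg_scale].
- by apply/andP; split; lra.
- have S'B u v : S' (u - v) = S' u - S' v.
    by apply: (ip_inj ipE) => z; rewrite ipDr ipNr -!SS' ipDr ipNr.
  exists (fun x => (1 - e * th) *: x - e *: S' (S x)); split.
  + have S0 : S 0 = 0 by rewrite SX linear0.
    by rewrite S0 -[X in S' X](subrr 0) S'B subrr !scaler0 subr0.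
  + move=> u v.
    have -> : (1 - e * th) *: u - e *: S' (S u) - ((1 - e * th) *: v - e *: S' (S v))
        = (1 - e * th) *: (u - v) - e *: S' (S (u - v)).
      by rewrite SX (linearB X) -SX S'B; vring ipE.
    move: (u - v) => w.
    rewrite -ler_sqr ?nnegrE ?mulr_ge0//; last by lra.
    rewrite exprMn !ipE.
    have -> : ip ((1 - e * th) *: w - e *: S' (S w)) ((1 - e * th) *: w - e *: S' (S w)) =
        (1 - e * th) ^+ 2 * ip w w - 2 * e * (1 - e * th) * ip (S w) (S w)
        + e ^+ 2 * ip (S' (S w)) (S' (S w)).
      rewrite (SS' w (S w)) !(ipDl, ipDr, ipNl, ipNr, ipZl, ipZr) (ipC ip (S' (S w)) w).
      ring.
    have h : e ^+ 2 * ip (S' (S w)) (S' (S w)) <= e * (e * M ^+ 2) * ip (S w) (S w).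
      rewrite -!ipE (expr2 e) -!mulrA ler_wpM2l ?(ltW e0)// ler_wpM2l ?(ltW e0)//.
      by rewrite mulrA -expr2 -exprMn ler_sqr ?nnegrE ?mulr_ge0 ?(ltW M0).
    have h2 : e * (e * M ^+ 2) * ip (S w) (S w) <=
        e * (2 * (1 - e * th)) * ip (S w) (S w).
      rewrite ler_wpM2r -?ipE ?sqr_ge0// ler_wpM2l ?(ltW e0)//; lra.
    by move: h h2; lra.
  + rewrite (_ : (fun x => _) = fun x => e *: ((fun x => S' x - S x) \o S) x).
      by apply: ucompactZ; exact: (ucompact_compr SM).
    by apply/funext => x; rewrite /N /=; vring ipE.
move=> x Ux; rewrite /f => fx; apply/U_sqr.
have NN : ip (N x) (N x) <= W ^+ 2 by rewrite -ipE ler_sqr ?nnegrE ?NW.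
have d : ip (x - x0) (x - x0) <= r ^+ 2 by apply/U_sqr.
have Nx : ip (N x) (x0 - x) <= - (n / 2).
  rewrite ipDl ipZl; have := ip_le Ux; rewrite ler_norml => /andP[_ h].
  have : th * ip x (x0 - x) <= th * (B * r) by rewrite ler_wpM2l// ltW.
  by move: fx; lra.
move: (N x) NN Nx => y NN Nx.
have -> : ip (x - e *: y - x0) (x - e *: y - x0) =
    ip (x - x0) (x - x0) + 2 * e * ip (y) (x0 - x) + e * (e * ip (y) (y)).
  rewrite !(ipDl, ipDr, ipNl, ipNr, ipZl, ipZr) (ipC ip x0 x) (ipC ip x (y)).
  by rewrite (ipC ip x0 (y)); ring.
have h1 : 2 * e * ip (y) (x0 - x) <= 2 * e * - (n / 2).
  by rewrite ler_wpM2l ?mulr_ge0 ?(ltW e0).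
have h2 : e * (e * ip (y) (y)) <= e * n.
  by rewrite ler_wpM2l ?(ltW e0)//; apply: le_trans eW; rewrite ler_wpM2l// ltW.
by lra.
Qed.

(* [f S] is weakly upper semicontinuous: [- (S^2 u, u) = - |S u|^2 - (S u, (S^* - S) u)]
   is the sum of a concave function and of a weakly continuous one. *)
Lemma square_usc S I (G : set_system I) (UG : UltraFilter G) (u : I -> H) x :
  alg S -> (\forall i \near G, U (u i)) ->
  (forall z, ip (u i) z @[i --> G] --> ip x z) ->
  exists2 h : I -> R, (forall i, f S (u i) <= h i) & h i @[i --> G] --> f S x.
Proof.
move=> aS Uu ux; have [S' [SS' cS]] := adj aS.
have [M M0 SM] := alg_bounded F_bounded aS.
have uB : \forall i \near G, `|u i| <= B by apply: filterS Uu => i; exact: U_le.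
pose D v := S' v - S v.
(* Compactness gives a strong limit, which weak convergence identifies. *)
have Du : D (u i) @[i --> G] --> D x.
  have /cvg_ex[l Dl] := cS _ _ UG _ _ uB.
  suff -> : D x = l by [].
  apply: (ip_inj ipE) => w; rewrite ![ip w _]ipC.
  have h : ip (S' (u i) - S (u i)) w @[i --> G] --> ip l w by exact: (ip_cvg ipE).
  suff h' : ip (S' (u i) - S (u i)) w @[i --> G] --> ip (D x) w.
    exact: norm_cvg_unique h' h.
  have -> : (fun i => ip (S' (u i) - S (u i)) w) =
      fun i => ip (u i) (S w) - ip (u i) (S' w).
    by apply/funext => i; rewrite ipDl ipNl (ipC ip _ w) -SS' ipC SS'.
  by rewrite /D ipDl ipNl (ipC ip _ w) -SS' (ipC ip (S w)) SS'; exact: cvgB.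
(* [- |S u|^2] is replaced by its tangent at [x], that is [|S x|^2 - 2 (S u, S x)]; the last term
   tends to 0. *)
exists (fun i => ip (u i) (S' (S' x0)) - 2 * ip (u i) (S' (S x)) + ip (S x) (S x)
   - ip (u i) (S' (D x)) - ip (S (u i)) (D (u i) - D x)).
  move=> i; have := sqr_ge0 `|S (u i) - S x|; rewrite ipE /f.
  rewrite -!SS' !(ipDl, ipDr, ipNl, ipNr) (ipC ip (S x) (S (u i))).
  rewrite (SS' (S (u i)) (u i)).
  by lra.
rewrite (_ : f S x = ip x (S' (S' x0)) - 2 * ip x (S' (S x)) + ip (S x) (S x)
   - ip x (S' (D x)) - 0); last first.
  rewrite /f -!SS' ipDr ipNr (SS' (S x) x) /D ipDr ipNr; ring.
apply: cvgB.
  apply: cvgB => //; apply: cvgD; last exact: cvg_cst.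
  by apply: cvgB => //; apply: cvgMl_tmp.
apply/norm_cvg0P/cvgrPdist_le => e e0.
have d0 : 0 < e / (M * B + 1) by rewrite divr_gt0// ltr_wpDl// mulr_ge0// ltW.
move/cvgrPdist_le : Du => /(_ _ d0); apply: filterS2 uB => i ui Dui.
rewrite sub0r normrN normr_id; apply: le_trans (cauchy_schwarz ipE _ _) _.
rewrite distrC in Dui.
apply: (@le_trans _ _ ((M * B + 1) * (e / (M * B + 1)))); last first.
  by rewrite mulrC divfK// gt_eqF// ltr_wpDl// mulr_ge0// ltW.
rewrite ler_pM//; apply: le_trans (SM _) _.
by apply: (@le_trans _ _ (M * B)); rewrite ?lerDl// ler_wpM2l// ltW.
Qed.

(** Otherwise the uncovered sets generate a filter. A weak limit [x] along it lies in [U] with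
    [g x >= 0], so [x] and [x0 - x] are nonzero; semicontinuity gives [f S x >= 0] for all [S],
    against [square_negative]. *)
Lemma ball_cover : r < `|x0| -> exists (Ss : seq (H -> H)) (n : R),
  [/\ forall S, List.In S Ss -> alg S, 0 < n &
    forall x, U x -> g x <= - n \/ exists2 S, List.In S Ss & f S x <= - n].
Proof.
move=> rx0; apply: contrapT => nocover.
pose Bs (p : seq (H -> H) * R) := [set x | [/\ U x, - p.2 < g x &
  forall S, List.In S p.1 -> - p.2 < f S x]].
pose D := [set p : seq (H -> H) * R |
  0 < p.2 /\ forall S, List.In S p.1 -> alg S].
have FB : ProperFilter (filter_from D Bs).
  apply: filter_from_proper.
    apply: filter_from_filter; first by exists ([::], 1).
    move=> [Ss n] [Ss' n'] [n0 aSs] [n'0 aSs']; exists (Ss ++ Ss', Num.min n n').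
      split=> [|S]; rewrite /= ?lt_min ?n0//.
      by move=> /List.in_app_iff[]; [exact: aSs|exact: aSs'].
    move=> x [Ux]; rewrite /= oppr_min gt_max => /andP[gx gx'] fx.
    split; split => // S SSs; have := fx S; rewrite gt_max List.in_app_iff.
      by move=> /(_ (or_introl SSs))/andP[].
    by move=> /(_ (or_intror SSs))/andP[].
  move=> [Ss n] [/= n0 aSs]; apply: contrapT => nB; apply: nocover.
  exists Ss, n; split => // x Ux.
  have [gx|gx] := leP (g x) (- n); [by left|right].
  apply: contrapT => fx; apply: nB; exists x; split => // S SSs.
  by rewrite ltNge; apply/negP => fSx; apply: fx; exists S.
have [G [UG GF]] := ultraFilterLemma FB.
have GB Ss n : 0 < n -> (forall S, List.In S Ss -> alg S) ->
    \forall x \near G, Bs (Ss, n) x.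
  by move=> n0 aSs; apply: GF; exists (Ss, n).
have GU : \forall x \near G, U x by apply: filterS (GB [::] 1 _ _) => // x [].
have [|x xl] := @weak_limit _ _ _ ipE _ G UG id B.
  by apply: filterS GU => x; exact: U_le.
have Ux : U x.
  have [xx0|xx0] := eqVneq (x - x0) 0; first by rewrite /U xx0 normr0 ltW.
  have xl0 : ip (u - x0) (x - x0) @[u --> G] --> ip (x - x0) (x - x0).
    rewrite ipDl ipNl; under eq_fun do rewrite ipDl ipNl.
    by apply: cvgB; [exact: xl|exact: cvg_cst].
  rewrite /U -(ler_pM2r (_ : 0 < `|x - x0|)) ?normr_gt0// -expr2 ipE.
  apply: (closed_cvg _ (@closed_le _ (r * `|x - x0|)) _ _ xl0).
  apply: filterS GU => u Uu; apply: le_trans (ler_norm _) _.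
  by apply: le_trans (cauchy_schwarz ipE _ _) _; rewrite ler_wpM2r.
have xN0 : x != 0.
  by apply/eqP => xE; move: Ux rx0; rewrite /U xE sub0r normrN leNgt => /negbTE ->.
have gx : 0 <= g x.
  apply/ler_addgt0Pr => e e0; rewrite -lerBlDr sub0r.
  have gl : g u @[u --> G] --> g x.
    have gE u : g u = ip x0 x0 - ip u x0 - r ^+ 2.
      by rewrite /g ipDr ipNr (ipC ip x0 u).
    rewrite gE; under eq_fun do rewrite gE.
    by apply: cvgB; [apply: cvgB; [exact: cvg_cst|exact: xl]|exact: cvg_cst].
  apply: (closed_cvg _ (@closed_ge _ (- e)) _ _ gl).
  by apply: filterS (GB [::] e e0 _) => // u [_ /ltW].
(* [g x0 = - r^2] is negative. *)
have yN0 : x0 - x != 0.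
  apply/eqP => yE; move: gx; rewrite /g yE ip0r sub0r oppr_ge0.
  by rewrite leNgt exprn_gt0.
have [S aS] := square_negative ipE dimH F_bounded F_comm F_esa no_inv xN0 yN0.
apply/negP; rewrite -leNgt -/(f S x); apply/ler_addgt0Pr => e e0.
rewrite -lerBlDr sub0r.
have [h fh hl] := square_usc UG aS GU xl.
apply: (closed_cvg _ (@closed_ge _ (- e)) _ _ hl).
have aSs S' : List.In S' [:: S] -> alg S' by case=> // <-.
apply: filterS (GB [:: S] e e0 aSs) => u [_ _ /(_ S)].
by move=> /(_ (or_introl erefl)) /ltW fu; exact: le_trans (fh u).
Qed.

Lemma ball_contradiction : ~ ucompact (id : H -> H) -> r < `|x0| -> False.
Proof.
move=> nc rx0; have [Ss [n [aSs n0 cover]]] := ball_cover rx0.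
have ctr T q : alg T -> 0 <= q < 1 -> ess q T -> contracting F T.
  move=> aT q01 eT; split => //.
  exact: (ess_lt1 ipE F_bounded F_comm F_esa no_inv nc aT q01 eT).
have [T0 [q0 [aT0 q001 eT0 UT0]]] := radial_step n0.
have [Ts [TsP TsU]] : exists Ts, (forall T, List.In T Ts -> contracting F T) /\
    forall S, List.In S Ss -> exists2 T, List.In T Ts &
      forall x, U x -> f S x <= - n -> U (T x).
  elim: Ss aSs {cover} => [|S Ss IH] aSs; first by exists [::].
  have [Ts [TsP TsU]] := IH (fun S' S'Ss => aSs S' (or_intror S'Ss)).
  have [T [q [aT q01 eT UT]]] := square_step (aSs S (or_introl erefl)) n0.
  exists (T :: Ts); split=> [T' [<-|]|S' [<-|/TsU[T' T'Ts UT']]].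
  - exact: ctr eT.
  - exact: TsP.
  - by exists T => //; left.
  - by exists T' => //; right.
have m0 : 0 < `|x0| - r by rewrite subr_gt0.
apply: (@no_trapping _ _ _ F_bounded F_comm (T0 :: Ts) U _ x0 _ m0).
- by move=> T [<-|/TsP//]; exact: ctr eT0.
- move=> v Uv; rewrite lerBlDr -lerBlDl; apply: le_trans Uv.
  by rewrite distrC; exact: lerB_dist.
- by rewrite /U subrr normr0 ltW.
- move=> x Ux; have [gx|[S SSs fx]] := cover x Ux.
    by exists T0; [left|exact: UT0].
  by have [T TTs UT] := TsU S SSs; exists T; [right|exact: UT].
Qed.

End Ball.
End Irreducible.

(** * The finite-dimensional case *)

Section CompactIdentity.
Context {R : realType} {H : completeNormedModType R}.
Variables (ip : {dot H for idfun}) (ipE : hilbert_norm ip).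
Hypothesis dimH : dim_ge H 3.
Variable F : set {linear H -> H}.
Hypothesis F_bounded : forall T : {linear H -> H}, F T -> bounded_operator T.
Hypothesis F_comm : forall T S : {linear H -> H}, F T -> F S -> T \o S = S \o T.
Hypothesis F_esa :
  forall T : {linear H -> H}, F T -> essentially_selfadjoint ip T.
Hypothesis no_inv : forall L, ~ invariant_subspace F L.
Hypothesis id_compact : ucompact (id : H -> H).
Implicit Types (T S J : H -> H) (u v w x y z : H).

Local Notation alg := (alg F).
Let adj S (aS : alg S) := alg_adjoint ipE F_bounded F_comm F_esa aS.
Let acomm S T (aS : alg S) (aT : alg T) := alg_comm F_comm aS aT.
Let kernel S z (aS : alg S) := alg_kernel ipE F_bounded F_comm F_esa no_inv aS (z := z).

(** Unit vectors with images tending to 0 would accumulate at a unit vector of the kernel. *)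
Lemma alg_bounded_below T : alg T -> (forall v, T v = 0 -> v = 0) ->
  exists2 c : R, 0 < c & forall v, c * `|v| <= `|T v|.
Proof.
move=> aT Tinj; have [X TX] := alg_linear aT.
have [M M0 TM] := alg_bounded F_bounded aT.
apply: contrapT => nb.
have /choice[f fP] : forall n : nat, exists v, `|v| = 1 /\ `|T v| < n.+1%:R^-1.
  move=> n; apply: contrapT => nv; apply: nb; exists n.+1%:R^-1 => [|v].
    by rewrite invr_gt0.
  rewrite leNgt; apply/negP => Tv; apply: nv.
  have v0 : 0 < `|v|.
    rewrite normr_gt0; apply/eqP => v0; move: Tv.
    by rewrite v0 normr0 mulr0 ltNge normr_ge0.
  exists (`|v|^-1 *: v); rewrite TX linearZ /= -TX !normrZ ger0_norm ?invr_ge0//.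
  by rewrite mulVf ?gt_eqF//; split => //; rewrite ltr_pdivrMl// [ltRHS]mulrC.
have [G [UG Gle]] := ultraFilterLemma (@eventually_filter).
have [|l fl] := (cvg_ex _).1 (id_compact UG (u := f) (M := 1) _).
  by apply: nearW => n; rewrite (fP n).1.
have l1 : `|f n| @[n --> G] --> `|l| by exact: cvg_norm.
have Tl : T (f n) @[n --> G] --> T l.
  by rewrite TX; apply: bounded_cvg fl => x; rewrite -TX.
have T0 : T (f n) @[n --> G] --> (0 : H).
  apply/norm_cvg0P/cvgrPdist_le => e e0.
  have Ge : \forall n \near G, n.+1%:R^-1 < e.
    by apply: Gle; exact: near_infty_natSinv_lt (PosNum e0).
  apply: filterS Ge => n ne; rewrite sub0r normrN normr_id ltW//.
  by apply: lt_trans ne; exact: (fP n).2.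
have l0 := Tinj _ (norm_cvg_unique Tl T0).
rewrite (_ : (fun n => `|f n|) = fun=> 1) in l1; last first.
  by apply/funext => n; exact: (fP n).1.
have {}l1 : `|l| = 1 by exact: norm_cvg_unique l1 (cvg_cst _).
by move: l1; rewrite l0 normr0 => /esym/eqP; rewrite oner_eq0.
Qed.

(** If [T] is injective with lower bound [c], no power of [U = T / c] shrinks norms, so
    [ess_quarter], with zero as the Lipschitz part, yields a vanishing quadratic in [U]. *)
Lemma alg_quadratic T : alg T -> exists a d : R, 0 <= d /\
  forall v, T (T v) - (2 * a) *: T v + a ^+ 2 *: v = - d *: v.
Proof.
move=> aT; have [X TX] := alg_linear aT.
have [[z [z0 Tz]]|Tinj] := pselect (exists z, z != 0 /\ T z = 0).
  have T0 := kernel aT Tz z0; exists 0, 0; split=> // v.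
  by rewrite !T0 scaler0 subr0 add0r expr0n oppr0.
have {}Tinj v : T v = 0 -> v = 0.
  by move=> Tv; apply/eqP; apply: contrapT => /negP v0; apply: Tinj; exists v.
have [c c0 Tc] := alg_bounded_below aT Tinj.
have aU : alg (fun v => c^-1 *: T v) := alg_scalel c^-1 aT.
set U := fun v => _ in aU; have [Y UY] := alg_linear aU.
have [M M0 UM] := alg_bounded F_bounded aU.
have U_ge v : `|v| <= `|U v|.
  by rewrite /U normrZ gtr0_norm ?invr_gt0// ler_pdivlMl.
have Un_ge n v : `|v| <= `|iter n U v|.
  by elim: n => //= n IH; apply: le_trans IH (U_ge _).
have [z [z0 _ _]] := orthogonal2 ip 0 0 dimH.
have eU : ess 4^-1 U.
  exists (fun=> 0); split=> // [u v|].
    by rewrite subrr normr0 mulr_ge0.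
  rewrite (_ : (fun x => U x - 0) = Y \o id).
    by apply: ucompact_compl id_compact => x; rewrite -UY; exact: UM.
  by apply/funext => x /=; rewrite subr0 UY.
have [[n n0 Un]|[s [a [s01 a1 Q0]]]] :=
    ess_quarter ipE F_bounded F_comm F_esa no_inv aU eU.
  have := le_trans (Un_ge n z) (Un z).
  by rewrite -normr_gt0 in z0; lra.
have s0 : s != 0.
  apply/eqP => s0; have := Q0 z; rewrite s0 /quad mulr0 mul0r expr0n /= !scale0r.
  by rewrite subr0 addr0 => /eqP; rewrite (negbTE z0).
(* Multiplied by [k^2], the quadratic becomes [T^2 - 2 a k T + k^2 = 0]; complete the square. *)
pose k := c / s.
exists (a * k), ((1 - a ^+ 2) * k ^+ 2); split.
  by rewrite mulr_ge0 ?sqr_ge0// subr_ge0 -real_normK ?num_real// exprn_ile1.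
move=> v; have UU : U (U v) = c^-1 *: (c^-1 *: T (T v)).
  by rewrite /U TX [X (_ *: _)]linearZ.
have Qv := Q0 v; rewrite /quad UU /U in Qv.
apply/eqP; rewrite -subr_eq0; apply/eqP.
rewrite -[RHS](scaler0 _ (k ^+ 2)) -Qv.
apply: (ip_inj ipE) => y.
rewrite [LHS](ipC ip) [RHS](ipC ip) ?(ipDl, ipNl, ipZl) /k.
by field; rewrite s0 (gt_eqF c0).
Qed.

(** Nonzero elements of the algebra are injective. *)
Lemma alg_zero_divisor S T : alg S -> alg T -> (forall v, S (T v) = 0) ->
  (forall v, S v = 0) \/ (forall v, T v = 0).
Proof.
move=> aS aT ST; have [z [z0 _ _]] := orthogonal2 ip 0 0 dimH.
have [Tz|Tz] := eqVneq (T z) 0; first by right; exact: kernel aT Tz z0.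
by left; exact: kernel aS (ST z) Tz.
Qed.

(** Shifting [S] gives [M] with [M^2 = - e]. If some [J^2 = - d < 0], then [d M^2 = e J^2] factors
    and makes [M] a multiple of [J]; otherwise [M^2 = 0] and [S] is scalar. *)
Lemma alg_complex : exists J, alg J /\
  forall S, alg S -> exists a b : R, forall v, S v = a *: v + b *: J v.
Proof.
have sub_sq S a d : alg S ->
    (forall v, S (S v) - (2 * a) *: S v + a ^+ 2 *: v = - d *: v) ->
    let M v := S v - a *: v in alg M /\ forall v, M (M v) = - d *: v.
  move=> aS SP /=; split; first exact: alg_sub aS (alg_scale F a).
  have [X SX] := alg_linear aS.
  by move=> v; rewrite -SP SX (linearB X) [X (_ *: _)]linearZ /=; vring ipE.
have [[J [d [aJ d0 JJ]]]|noJ] := pselect (exists J (d : R),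
    [/\ alg J, 0 < d & forall v, J (J v) = - d *: v]); last first.
  exists id; split=> [|S aS]; first exact: alg_id.
  have [a [d [d0 SP]]] := alg_quadratic aS.
  have [aM MM] := sub_sq _ _ _ aS SP.
  have {}d0 : d = 0.
    apply/eqP; apply: contrapT => /negP dN; apply: noJ.
    by exists (fun v => S v - a *: v), d; split => //; rewrite lt_neqAle eq_sym dN.
  have M0 v : S v - a *: v = 0.
    by case: (alg_zero_divisor aM aM _) => [u||]; first by rewrite MM d0 oppr0 scale0r.
  by exists a, 0 => v; rewrite scale0r addr0; apply/eqP; rewrite -subr_eq0 M0.
exists J; split=> // S aS.
have [a [e [e0 SP]]] := alg_quadratic aS.
pose M v := S v - a *: v.
have [aM MM] : alg M /\ forall v, M (M v) = - e *: v by exact: sub_sq aS SP.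
have [Y JY] := alg_linear aJ; have [Z MZ] := alg_linear aM.
pose p := Num.sqrt e; pose q := Num.sqrt d.
have pe : p ^+ 2 = e by rewrite sqr_sqrtr.
have qd : q ^+ 2 = d by rewrite sqr_sqrtr// ltW.
have q0 : q != 0 by rewrite gt_eqF// sqrtr_gt0.
have aP := alg_sub (alg_scalel p aJ) (alg_scalel q aM).
have aP' := alg_add (alg_scalel p aJ) (alg_scalel q aM).
have [v|h|h] := alg_zero_divisor aP aP'.
- have -> : J (p *: J v + q *: M v) = p *: J (J v) + q *: J (M v).
    by rewrite JY (linearD Y) ![Y (_ *: _)]linearZ.
  have -> : M (p *: J v + q *: M v) = p *: M (J v) + q *: M (M v).
    by rewrite MZ (linearD Z) ![Z (_ *: _)]linearZ.
  rewrite JJ MM (acomm aM aJ) -pe -qd.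
  by apply/eqP; rewrite subr_eq0; apply/eqP; vring ipE.
- exists a, (p / q) => v; have /eqP := h v; rewrite subr_eq0 => /eqP hv.
  rewrite mulrC -scalerA hv scalerA mulVf// scale1r /M; by vring ipE.
- exists a, (- (p / q)) => v; have /eqP := h v; rewrite addr_eq0 => /eqP hv.
  rewrite mulrC -mulrN -scalerA scaleNr hv opprK scalerA mulVf// scale1r /M; by vring ipE.
Qed.

Lemma compact_identity_contradiction : False.
Proof.
have [J [aJ JP]] := alg_complex.
have [x [x0 _ _]] := orthogonal2 ip 0 0 dimH.
pose P := [set w | ip x w = 0 /\ ip (J x) w = 0].
have full : forall z w, P w -> ip z w = 0.
  apply: (@transitive_full _ _ _ no_inv [set z | forall w, P w -> ip z w = 0]
    _ _ _ _ x _ x0) => /=.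
  - exact: closed_orthogonal.
  - by move=> w _; exact: ip0l.
  - by move=> a u v Pu Pv w Pw; rewrite ipDl ipZl Pu// Pv// mulr0 addr0.
  (* Stability needs [J^2] as well, again a combination of 1 and [J]. *)
  - move=> S aS z zP w [xw Jw]; have [S' [SS' _]] := adj aS.
    rewrite SS'; apply: zP; have [a [b SE]] := JP _ aS.
    have [a' [b' JE]] := JP _ (alg_comp aJ aJ).
    rewrite /P /= -!SS' !SE; rewrite /= in JE.
    by rewrite JE !(ipDl, ipZl) xw Jw !mulr0 !addr0 !mulr0 addr0.
  - by move=> w [].
have [w [w0 xw Jw]] := orthogonal2 ip x (J x) dimH.
have := full w w; rewrite /P /= ipC xw (ipC ip (J x)) Jw => /(_ (conj erefl erefl)).
by move/eqP; rewrite -ipE expf_eq0 /= normr_eq0 (negbTE w0).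
Qed.

End CompactIdentity.

Theorem theorem3p3 (R : realType) (H : completeNormedModType R)
    (ip : {dot H for idfun}) (ip_norm : hilbert_norm ip)
    (dimH : dim_ge H 3)
    (F : set {linear H -> H})
    (F_bounded : forall T : {linear H -> H}, F T -> bounded_operator T)
    (F_comm : forall T S : {linear H -> H}, F T -> F S -> T \o S = S \o T)
    (F_esa : forall T : {linear H -> H}, F T -> essentially_selfadjoint ip T) :
  exists L : set H, invariant_subspace F L.
Proof.
apply: contrapT => noL.
have no_inv L : ~ invariant_subspace F L by move=> FL; apply: noL; exists L.
have [cid|nc] := pselect (ucompact (id : H -> H)).
  exact: (compact_identity_contradiction ip_norm dimH F_bounded F_comm F_esa no_inv cid).
(* The ball of radius [|x| / 2] around a nonzero [x] avoids 0. *)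
have [x [x0 _ _]] := orthogonal2 ip 0 0 dimH; rewrite -normr_gt0 in x0.
apply: (ball_contradiction ip_norm dimH F_bounded F_comm F_esa no_inv
  (x0 := x) (r := `|x| / 2) _ nc); lra.
Qed.
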